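(* Let $P$ be an irreducible transition matrix on a countably infinite set $V$, reversible with respect to a measure $\pi$, and assume that $\pi(V)=\infty$. Then $$\chi_\ell(u)\;\le\;\zeta_\ell(u)\;\le\;\frac{\ell\log 2}{\Lambda(u\,2^{\ell+2})}\qquad\text{for all }u>0\text{ and }\ell\in\mathbb{N}.$$ Moreover, there exist absolute constants $\ell\in\mathbb{N}$ and $c\in(0,1)$ (not depending on $V,P,\pi$) such that for all $u>0$ $$\chi_\ell(u)\;\ge\;\frac{c}{\Lambda(u)}\;\ge\;\frac{c}{\ell\log2}\,\zeta_\ell(2^{-\ell-2}u).$$
   Context: Reversible means $\pi(x)P(x,y)=\pi(y)P(y,x)$ for all $x,y\in V$, where $0<\pi(x)<\infty$ for all $x$. For $p\in[1,\infty)$ and $f:V\to\mathbb{R}$, $\|f\|_p:=(\sum_v\pi(v)|f(v)|^p)^{1/p}$, and $\ell^p(V,\pi):=\{f:\|f\|_p<\infty\}$. For a signed measure $\sigma$ on $V$, $\|\sigma\|_{p,\pi}:=\|\sigma/\pi\|_p$ where $(\sigma/\pi)(v):=\sigma(v)/\pi(v)$. $\ell^2(\mathcal{P}(V),\pi)$ is the set of probability distributions $\mu$ on $V$ with $\|\mu\|_{2,\pi}<\infty$. For $B\subseteq V$, $P_B(x,y):=P(x,y)\mathbf 1\{x,y\in B\}$, and $\|P_B\|:=\sup\{\|P_Bf\|_2:f\in\ell^2(V,\pi),\|f\|_2=1\}$. For $u>0$, $\Lambda(u):=\inf\{1-\|P_B\|:B\subset V,\ 0<\pi(B)\le u\}$.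 A nonempty set $B$ is irreducible if $\sum_{n\ge0}(P_B)^n(x,y)>0$ for all $x,y\in B$; $\mathrm{FI}(V,u)$ is the collection of nonempty, finite, irreducible subsets $B$ of $V$ with $\pi(B)\le u$. For $B$ with $0<\pi(B)<\infty$, $\pi_B(x):=\frac{\pi(x)\mathbf 1\{x\in B\}}{\pi(B)}$. For $t\ge0$, $P_t:=e^{t(P-I)}$. For $\ell\in\mathbb{N}=\{1,2,\ldots\}$ and $u>0$, $$\zeta_\ell(u):=\inf\{t\ge0:\ \|\mu P_t\|_{2,\pi}^2\le2^{-\ell}\|\mu\|_{2,\pi}^2\ \text{for all }\mu\in\ell^2(\mathcal{P}(V),\pi)\text{ such that }u\|\mu\|_{2,\pi}^2\ge1\}$$ (equivalently, $\inf\{t\ge0:\|P_tf\|_2^2\le2^{-\ell}\|f\|_2^2$ for all $f\in\ell^2(V,\pi)$ with $u\|f\|_2^2\ge\|f\|_1^2\}$), and $$\chi_\ell(u):=\inf\{t\ge0:\ \|\pi_BP_t\|_{2,\pi}^2\le2^{-\ell}\|\pi_B\|_{2,\pi}^2\ \text{for all }B\in\mathrm{FI}(V,u)\}.$$ Conventions: $\inf\emptyset=\infty$, $1/0=\infty$, $1/\infty=0$. *)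

(* Defs.v *)
From HB Require Import structures.
From mathcomp Require Import all_boot all_order all_algebra.
From mathcomp Require Import all_classical all_reals all_analysis.
Set Implicit Arguments.
Unset Strict Implicit.
Unset Printing Implicit Defensive.
Import Order.TTheory GRing.Theory Num.Theory.
Import numFieldNormedType.Exports.
Local Open Scope classical_set_scope.
Local Open Scope ring_scope.

(* Sum over V of an absolutely summable real family. [esum] is only meaningful
   for nonnegative families, hence the splitting f = f^+ - f^-. Every family
   summed below with [vsum] is absolutely summable when P is a transition
   matrix reversible with respect to pi. *)
Definition vsum (R : realType) (V : choiceType) (f : V -> R) : R :=
  fine (\esum_(v in [set: V]) (f^\+ v)%:E)
  - fine (\esum_(v in [set: V]) (f^\- v)%:E).

Definition kid (R : realType) (V : choiceType) : V -> V -> R :=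
  fun x y => (x == y)%:R.

Definition kmul (R : realType) (V : choiceType) (A B : V -> V -> R) :
  V -> V -> R := fun x y => vsum (fun z => A x z * B z y).

Definition kpow (R : realType) (V : choiceType) (A : V -> V -> R) (n : nat) :
  V -> V -> R := iter n (kmul A) (@kid R V).

(* e^A = \sum_n A^n / n!, entrywise *)
Definition kexp (R : realType) (V : choiceType) (A : V -> V -> R) :
  V -> V -> R :=
  fun x y => limn (series (fun n => kpow A n x y / n`!%:R)).

(* (A f)(x) = \sum_y A(x, y) f(y) *)
Definition kapp (R : realType) (V : choiceType) (A : V -> V -> R) (f : V -> R) :
  V -> R := fun x => vsum (fun y => A x y * f y).

(* (sigma A)(y) = \sum_x sigma(x) A(x, y) *)
Definition kact (R : realType) (V : choiceType) (sigma : V -> R)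
  (A : V -> V -> R) : V -> R := fun y => vsum (fun x => sigma x * A x y).

Definition krestr (R : realType) (V : choiceType) (P : V -> V -> R)
  (B : set V) : V -> V -> R :=
  fun x y => P x y * ((x \in B) && (y \in B))%:R.

(* P_t = e^{t(P-I)} *)
Definition heat (R : realType) (V : choiceType) (P : V -> V -> R) (t : R) :
  V -> V -> R := kexp (fun x y => t * (P x y - kid R x y)).

Definition transition_matrix (R : realType) (V : choiceType)
  (P : V -> V -> R) : Prop :=
  (forall x y, 0 <= P x y) /\
  (forall x, \esum_(y in [set: V]) (P x y)%:E = 1%E).

Definition reversible (R : realType) (V : choiceType) (P : V -> V -> R)
  (pi : V -> R) : Prop :=
  (forall x, 0 < pi x) /\ (forall x y, pi x * P x y = pi y * P y x).

Definition irreducible_on (R : realType) (V : choiceType) (P : V -> V -> R)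
  (B : set V) : Prop :=
  B !=set0 /\
  forall x y, B x -> B y ->
    (0 < \sum_(0 <= n <oo) (kpow (krestr P B) n x y)%:E)%E.

Definition mass (R : realType) (V : choiceType) (pi : V -> R) (B : set V) :
  \bar R := \esum_(v in B) (pi v)%:E.

Definition lnorm (R : realType) (V : choiceType) (pi : V -> R) (p : R)
  (f : V -> R) : \bar R :=
  ((\esum_(v in [set: V]) (pi v * `|f v| `^ p)%:E) `^ p^-1)%E.

Definition mnorm (R : realType) (V : choiceType) (pi : V -> R) (p : R)
  (sigma : V -> R) : \bar R := lnorm pi p (fun v => sigma v / pi v).

Definition prob_dist (R : realType) (V : choiceType) (mu : V -> R) : Prop :=
  (forall v, 0 <= mu v) /\ \esum_(v in [set: V]) (mu v)%:E = 1%E.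

(* l^2(P(V), pi) *)
Definition prob_l2 (R : realType) (V : choiceType) (pi : V -> R) :
  set (V -> R) := [set mu | prob_dist mu /\ (mnorm pi 2 mu < +oo)%E].

(* operator norm on l^2(V, pi) *)
Definition opnorm (R : realType) (V : choiceType) (pi : V -> R)
  (A : V -> V -> R) : \bar R :=
  ereal_sup [set lnorm pi 2 (kapp A f) | f in
    [set f : V -> R | (lnorm pi 2 f < +oo)%E /\ lnorm pi 2 f = 1%E]].

Definition Lambda (R : realType) (V : choiceType) (P : V -> V -> R)
  (pi : V -> R) (u : R) : \bar R :=
  ereal_inf [set (1 - opnorm pi (krestr P B))%E | B in
    [set B : set V | (0 < mass pi B)%E /\ (mass pi B <= u%:E)%E]].

Definition FI (R : realType) (V : choiceType) (P : V -> V -> R)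
  (pi : V -> R) (u : R) : set (set V) :=
  [set B | [/\ B !=set0, finite_set B, irreducible_on P B
             & (mass pi B <= u%:E)%E]].

Definition cond_dist (R : realType) (V : choiceType) (pi : V -> R)
  (B : set V) : V -> R := fun x => pi x * (x \in B)%:R / fine (mass pi B).

Definition zeta (R : realType) (V : choiceType) (P : V -> V -> R)
  (pi : V -> R) (l : nat) (u : R) : \bar R :=
  ereal_inf [set t%:E | t in [set t : R | 0 <= t /\
    forall mu, prob_l2 pi mu ->
      (1 <= u%:E * mnorm pi 2 mu ^+ 2)%E ->
      (mnorm pi 2 (kact mu (heat P t)) ^+ 2
         <= (2 ^- l)%:E * mnorm pi 2 mu ^+ 2)%E]].

Definition chi (R : realType) (V : choiceType) (P : V -> V -> R)
  (pi : V -> R) (l : nat) (u : R) : \bar R :=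
  ereal_inf [set t%:E | t in [set t : R | 0 <= t /\
    forall B, FI P pi u B ->
      (mnorm pi 2 (kact (cond_dist pi B) (heat P t)) ^+ 2
         <= (2 ^- l)%:E * mnorm pi 2 (cond_dist pi B) ^+ 2)%E]].

(* Main.v *)
Require Import Defs.
From HB Require Import structures.
From mathcomp Require Import all_boot all_order all_algebra.
From mathcomp Require Import all_classical all_reals all_analysis.
From mathcomp Require Import ring lra.
Set Implicit Arguments.
Unset Strict Implicit.
Unset Printing Implicit Defensive.
Import Order.TTheory GRing.Theory Num.Theory.
Import numFieldNormedType.Exports.
Local Open Scope classical_set_scope.
Local Open Scope ring_scope.

(* Write f_t = P_t f for f = mu/pi, and E(f) = <(I-P)f, f>.
   Upper bound: truncating g >= 0 at the level s = |g|_2^2 / (4 |g|_1) gives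
   E(g) >= E((g-s)_+) >= Lambda(4 |g|_1^2 / |g|_2^2) |g|_2^2 / 2. Since
   |f_t|_1 <= |f|_1, while |f_t|_2^2 stays above 2^-l |f|_2^2 the energy of f_t
   is at least Lambda(u 2^(l+2)) |f_t|_2^2 / 2; by log-convexity of
   t |-> |f_t|_2^2 the bound at the final time suffices.
   Lower bound: if f >= 0 is finitely supported on mass at most u and E(f) is
   small, then some dyadic slice of f, restricted to a connected component C of
   its support, has small energy while being maximal on an eighth of the mass
   of C. Then <P_t 1_C, h> >= |h|^2 - t E(h), with h the normalized slice, shows
   that pi_C P_t has not decayed.
   Both arguments are run for discrete lazy walks killed outside a finite set:
   P_t is the limit of ((1 - t/n) I + (t/n) P)^n entrywise, and each such power
   is an increasing limit over finite sets. *)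

(** Since [heat] is an entrywise series, its action on l^2 is never diagonalized. What spectral
    theory would give comes from positivity on finite sets: for e <= 1/2 the killed lazy operator Q
    is symmetric and positive semidefinite, and positivity of Q^n tested on a f + b Q f makes n |->
    <Q^n f, f> both convex and log-convex. Convexity yields the bound |h|^2 - t E(h), log-convexity
    the reduction to the final time. Killing acts in a favourable direction: it lowers transition
    weights, so a lower bound for a killed walk is one for P_t. The upper bound is argued by
    contradiction, because a strict lower bound on the energy of the flow can be seen on a finite
    set. Constants: in 2^(l+2), the factor 2^l reflects the fraction 2^-l of the squared norm still
    present and 4 the truncation level. The choice l = 8 makes 2^-8 the square of 1/16, small
    against the eighth of the mass on which a slice is maximal. Finally c = 2^-9 lies below 1 / (16
    * 24), where 24 is the loss in the dyadic decomposition. *)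

Lemma sqr_le_sqr (R : realDomainType) (a b : R) :
  - b <= a -> a <= b -> a ^+ 2 <= b ^+ 2.
Proof.
move=> ba ab; rewrite -subr_ge0 subr_sqr mulr_ge0 ?subr_ge0//.
by rewrite addrC -lerBlDr sub0r.
Qed.

(** The discriminant criterion serves twice: for Cauchy-Schwarz and for the log-convexity of
    moments. *)
Lemma quad_form_discr (R : realFieldType) (A B C : R) :
  (forall a b, 0 <= a ^+ 2 * A + 2 * a * b * B + b ^+ 2 * C) -> B ^+ 2 <= A * C.
Proof.
move=> quad.
have A0 : 0 <= A by have := quad 1 0; lra.
have : 0 <= C by have := quad 0 1; lra.
rewrite le_eqVlt => /orP[/eqP C0|C0].
  (* The pair (C, -B) used below is uninformative when C = 0; at this one the form equals -B^2 (A +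
     2). *)
  have := quad (- B) (A + 1); rewrite -C0 mulr0 addr0.
  rewrite (_ : _ + _ = - (B ^+ 2 * (A + 2))); last by ring.
  rewrite oppr_ge0 pmulr_lle0 ?mulr0//; lra.
rewrite -subr_ge0 -(pmulr_rge0 _ C0).
have := quad C (- B); congr (0 <= _); ring.
Qed.

(** * Dirichlet forms of killed lazy walks on finite sets *)

Section FiniteForms.
Variables (R : realFieldType) (V : eqType) (P : V -> V -> R) (pi : V -> R).
Hypothesis P_ge0 : forall x y, 0 <= P x y.
Hypothesis pi_gt0 : forall x, 0 < pi x.
Hypothesis piP_sym : forall x y, pi x * P x y = pi y * P y x.
Hypothesis row_le1 : forall (F : seq V) x, uniq F -> \sum_(y <- F) P x y <= 1.

(** Functions live on all of V and only the list F restricts the sums, so forms over different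
    finite sets are compared without transporting functions. *)
Definition ip (F : seq V) (f g : V -> R) : R :=
  \sum_(x <- F) pi x * f x * g x.

Definition papp (F : seq V) (f : V -> R) (x : V) : R :=
  \sum_(y <- F) P x y * f y.

Definition En (F : seq V) (f : V -> R) : R :=
  ip F f f - ip F (papp F f) f.

Definition plazy (e : R) (F : seq V) (f : V -> R) (x : V) : R :=
  (1 - e) * f x + e * papp F f x.

Let wsq_ge0 x a : 0 <= pi x * a ^+ 2.
Proof. by apply: mulr_ge0; [exact: ltW|exact: sqr_ge0]. Qed.

Let wPsq_ge0 x y a : 0 <= pi x * P x y * a ^+ 2.
Proof. by rewrite mulrAC; apply: mulr_ge0 => //; exact: wsq_ge0. Qed.

Lemma eq_papp F f g : {in F, f =1 g} -> papp F f =1 papp F g.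
Proof.
by move=> fg x; rewrite /papp !big_seq; apply: eq_bigr => y /fg ->.
Qed.

Lemma eq_ip F f g f' g' : {in F, f =1 f'} -> {in F, g =1 g'} ->
  ip F f g = ip F f' g'.
Proof.
move=> ff gg; rewrite /ip !big_seq; apply: eq_bigr => y yF.
by rewrite ff ?gg.
Qed.

Lemma eq_En F f g : {in F, f =1 g} -> En F f = En F g.
Proof.
move=> fg; rewrite /En (eq_ip fg fg); congr (_ - _).
by apply: eq_ip => // x _; exact: eq_papp.
Qed.

Lemma ipC F f g : ip F f g = ip F g f.
Proof. by apply: eq_bigr => x _; rewrite mulrAC. Qed.

Lemma ip_lin F a b f g h :
  ip F (fun x => a * f x + b * g x) h = a * ip F f h + b * ip F g h.
Proof.
by rewrite /ip !mulr_sumr -big_split; apply: eq_bigr => x _ /=; ring.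
Qed.

Lemma ip_ge0 F f : 0 <= ip F f f.
Proof.
by apply: sumr_ge0 => x _; rewrite -mulrA -expr2.
Qed.

Lemma ip_cauchy_schwarz F f g : ip F f g ^+ 2 <= ip F f f * ip F g g.
Proof.
apply: quad_form_discr => a b.
have := ip_ge0 F (fun x => a * f x + b * g x); set h := (fun x => _).
have hE u : ip F h u = a * ip F f u + b * ip F g u by exact: ip_lin.
rewrite hE (ipC F f h) (ipC F g h) !hE (ipC F g f).
by congr (0 <= _); ring.
Qed.

Lemma papp_lin F a b f g x :
  papp F (fun x => a * f x + b * g x) x = a * papp F f x + b * papp F g x.
Proof.
by rewrite /papp !mulr_sumr -big_split; apply: eq_bigr => y _ /=; ring.
Qed.

Lemma ipZ s F f g :
  ip F (fun x => s * f x) (fun x => s * g x) = s ^+ 2 * ip F f g.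
Proof. by rewrite /ip mulr_sumr; apply: eq_bigr => x _; ring. Qed.

Lemma pappZ s F f x : papp F (fun x => s * f x) x = s * papp F f x.
Proof. by rewrite /papp mulr_sumr; apply: eq_bigr => y _; ring. Qed.

Lemma EnZ s F f : En F (fun x => s * f x) = s ^+ 2 * En F f.
Proof.
rewrite /En ipZ mulrBr -(ipZ s F (papp F f)); congr (_ - _).
by apply: eq_ip => // x _; exact: pappZ.
Qed.

Lemma ip_pappE F f g :
  ip F (papp F f) g = \sum_(x <- F) \sum_(y <- F) pi x * P x y * (f y * g x).
Proof.
apply: eq_bigr => x _; rewrite /papp mulr_sumr mulr_suml.
by apply: eq_bigr => y _; ring.
Qed.

Lemma ip_papp_sym F f g : ip F (papp F f) g = ip F f (papp F g).
Proof.
rewrite (ipC F f) !ip_pappE exchange_big; apply: eq_bigr => x _ /=.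
by apply: eq_bigr => y _; rewrite piP_sym; ring.
Qed.

(** The sign s = -1 leads to the gradient form of I - P, the sign s = 1 to the positivity of I + P.
    Reversibility makes the two square terms equal. *)
Lemma double_sum_sq F (s : R) f : (s = 1 \/ s = -1) ->
  \sum_(x <- F) \sum_(y <- F) pi x * P x y * (f x + s * f y) ^+ 2 =
  2 * (\sum_(x <- F) pi x * f x ^+ 2 * \sum_(y <- F) P x y)
  + 2 * s * ip F (papp F f) f.
Proof.
move=> s1; have ss : s * s = 1 by case: s1 => ->; ring.
transitivity (\sum_(x <- F) \sum_(y <- F)
    (pi x * P x y * f x ^+ 2 + pi x * P x y * f y ^+ 2
     + 2 * s * (pi x * P x y * (f y * f x)))).
  apply: eq_bigr => x _; apply: eq_bigr => y _.
  rewrite (_ : (f x + s * f y) ^+ 2 =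
    f x ^+ 2 + (s * s) * f y ^+ 2 + 2 * s * (f y * f x)); last by ring.
  by rewrite ss; ring.
under eq_bigr do rewrite !big_split /=.
rewrite !big_split /=; congr (_ + _); last first.
  by rewrite ip_pappE mulr_sumr; apply: eq_bigr => x _; rewrite mulr_sumr.
have e1 : \sum_(x <- F) \sum_(y <- F) pi x * P x y * f x ^+ 2 =
    \sum_(x <- F) pi x * f x ^+ 2 * \sum_(y <- F) P x y.
  apply: eq_bigr => x _; rewrite mulr_sumr.
  by apply: eq_bigr => y _; ring.
rewrite -e1 mulr_natl mulr2n; congr (_ + _).
rewrite exchange_big; apply: eq_bigr => x _; apply: eq_bigr => y _ /=.
by rewrite piP_sym.
Qed.

(** The first sum is the killing term: 1 - \sum_(y <- F) P x y is the mass lost in one step from x.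
    In this form both terms visibly decrease under contractions of f. *)
Lemma EnE F f : 2 * En F f =
  2 * (\sum_(x <- F) pi x * f x ^+ 2 * (1 - \sum_(y <- F) P x y))
  + \sum_(x <- F) \sum_(y <- F) pi x * P x y * (f x - f y) ^+ 2.
Proof.
transitivity (2 * (\sum_(x <- F) pi x * f x ^+ 2 * (1 - \sum_(y <- F) P x y))
  + \sum_(x <- F) \sum_(y <- F) pi x * P x y * (f x + -1 * f y) ^+ 2);
  last by congr (_ + _); apply: eq_bigr => x _; apply: eq_bigr => y _;
          rewrite mulN1r.
rewrite double_sum_sq; last by right.
under eq_bigr do rewrite mulrBr mulr1.
rewrite sumrB /En.
rewrite (_ : ip F f f = \sum_(x <- F) pi x * f x ^+ 2); first by ring.
by apply: eq_bigr => x _; rewrite expr2 mulrA.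
Qed.

(** The Markov property of the Dirichlet form is stated for a whole family, so that the energies of
    all slices of f together are paid for by one copy of E(f). *)
Lemma sum_En_le (I : Type) (r : seq I) (F : seq V) (h : I -> V -> R) f :
  uniq F ->
  (forall x, \sum_(i <- r) h i x ^+ 2 <= f x ^+ 2) ->
  (forall x y, \sum_(i <- r) (h i x - h i y) ^+ 2 <= (f x - f y) ^+ 2) ->
  \sum_(i <- r) En F (h i) <= En F f.
Proof.
move=> uF h1 h2.
rewrite -(ler_pM2l (_ : 0 < 2 :> R)) ?ltr0n// mulr_sumr EnE.
under eq_bigr do rewrite EnE.
rewrite big_split /= -mulr_sumr; apply: lerD.
  rewrite ler_pM2l ?ltr0n// exchange_big /=; apply: ler_sum => x _.
  rewrite -mulr_suml -mulr_sumr ler_wpM2r ?subr_ge0 ?row_le1//.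
  by rewrite ler_pM2l.
rewrite exchange_big /=; apply: ler_sum => x _.
rewrite exchange_big /=; apply: ler_sum => y _.
rewrite -mulr_sumr; apply: ler_wpM2l => //.
by rewrite mulr_ge0 ?P_ge0// ltW.
Qed.

Lemma En_contr F h f : uniq F -> (forall x, h x ^+ 2 <= f x ^+ 2) ->
  (forall x y, (h x - h y) ^+ 2 <= (f x - f y) ^+ 2) -> En F h <= En F f.
Proof.
move=> uF h1 h2; have := @sum_En_le unit [:: tt] F (fun _ => h) f uF.
rewrite big_seq1; apply=> [x|x y]; by rewrite big_seq1.
Qed.

Lemma En_ge0 F f : uniq F -> 0 <= En F f.
Proof.
move=> uF; rewrite -(pmulr_rge0 (En F f) (_ : 0 < 2 :> R)) ?ltr0n// EnE.
apply: addr_ge0.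
  apply: mulr_ge0; first exact: ler0n.
  apply: sumr_ge0 => x _; apply: mulr_ge0 => //.
  by rewrite subr_ge0 row_le1.
by apply: sumr_ge0 => x _; apply: sumr_ge0.
Qed.

Lemma ip_papp_geN F f : uniq F -> - ip F f f <= ip F (papp F f) f.
Proof.
move=> uF; have := @double_sum_sq F 1 f (or_introl erefl).
have h1 : 0 <= \sum_(x <- F) \sum_(y <- F) pi x * P x y * (f x + 1 * f y) ^+ 2.
  by apply: sumr_ge0 => x _; apply: sumr_ge0.
have h2 : \sum_(x <- F) pi x * f x ^+ 2 * (\sum_(y <- F) P x y) <= ip F f f.
  apply: ler_sum => x _; rewrite -[leRHS]mulr1 -[X in _ <= X * _]mulrA -expr2.
  by apply: ler_wpM2l; rewrite ?row_le1.
lra.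
Qed.

Lemma ip_plazy e F f g :
  ip F (plazy e F f) g = (1 - e) * ip F f g + e * ip F (papp F f) g.
Proof. exact: ip_lin. Qed.

Lemma ip_plazyB e F f : ip F (plazy e F f) f = ip F f f - e * En F f.
Proof. by rewrite ip_plazy /En; ring. Qed.

Lemma ip_plazy_sym e F f g : ip F (plazy e F f) g = ip F f (plazy e F g).
Proof. by rewrite (ipC F f) !ip_plazy (ipC F g f) ip_papp_sym (ipC F f (papp F g)). Qed.

Lemma eq_plazy e F f g : {in F, f =1 g} -> {in F, plazy e F f =1 plazy e F g}.
Proof. by move=> fg x xF; rewrite /plazy fg// (eq_papp fg). Qed.

Lemma plazy_lin e F a b f g x : plazy e F (fun x => a * f x + b * g x) x =
  a * plazy e F f x + b * plazy e F g x.
Proof. by rewrite /plazy papp_lin; ring. Qed.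

Lemma iter_plazy_lin n e F a b f g :
  {in F, iter n (plazy e F) (fun x => a * f x + b * g x) =1
  fun x => a * iter n (plazy e F) f x + b * iter n (plazy e F) g x}.
Proof.
elim: n => [//|n IH] x xF /=.
by rewrite (eq_plazy _ IH)// plazy_lin.
Qed.

Lemma ip_iter_plazy_sym n e F f g :
  ip F (iter n (plazy e F) f) g = ip F f (iter n (plazy e F) g).
Proof.
elim: n f g => [//|n IH] f g.
by rewrite iterS ip_plazy_sym IH -iterSr.
Qed.

(** * Positivity and convexity of the moments of a killed lazy walk *)

Section Moments.
Variables (e : R) (F : seq V).
Hypotheses (e_ge0 : 0 <= e) (e_le : e <= 2^-1) (uF : uniq F).

Let q n f := ip F (iter n (plazy e F) f) f.

(** Symmetry moves one factor Q across the product, lowering n by 2. The case n = 1 is where e <=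
    1/2 enters: Q = (1 - 2e) I + e (I + P), a sum of two nonnegative forms. *)
Lemma moment_ge0 n f : 0 <= q n f.
Proof.
elim/ltn_ind: n f => -[|[|n]] IH f; first exact: ip_ge0.
  rewrite /q /= ip_plazy.
  have h1 : 0 <= e * (ip F f f + ip F (papp F f) f).
    by apply: mulr_ge0 => //; rewrite -lerBlDl sub0r ip_papp_geN.
  have h2 : 0 <= (1 - 2 * e) * ip F f f.
    apply: mulr_ge0; last exact: ip_ge0.
    by move: e_le; lra.
  lra.
by rewrite /q iterS iterSr ip_plazy_sym; apply: IH.
Qed.

Lemma momentDl m n f :
  ip F (iter m (plazy e F) f) (iter n (plazy e F) f) = q (m + n) f.
Proof. by rewrite -ip_iter_plazy_sym -iterD addnC. Qed.

(** This is the form of Q^n at a f + b Q f. The choice a = 1, b = -1 gives convexity of the moments,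
    the discriminant gives log-convexity. *)
Lemma moment_quad n a b f :
  0 <= a ^+ 2 * q n f + 2 * a * b * q n.+1 f + b ^+ 2 * q n.+2 f.
Proof.
have := moment_ge0 n (fun x => a * f x + b * plazy e F f x).
set Q := plazy e F.
rewrite /q; set g := (fun x => _).
have -> : ip F (iter n Q g) g =
    a * (a * ip F (iter n Q f) f + b * ip F (iter n Q (Q f)) f)
    + b * (a * ip F (iter n Q f) (Q f) + b * ip F (iter n Q (Q f)) (Q f)).
  rewrite (eq_ip (iter_plazy_lin n e a b f (Q f)) (fun _ _ => erefl)).
  rewrite ipC ip_lin; congr (a * _ + b * _); by rewrite ipC ip_lin.
rewrite -[in iter n Q (Q f)]/(iter 1 Q f) -iterD addn1.
rewrite -ip_plazy_sym -ip_plazy_sym -!iterS.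
by congr (0 <= _); ring.
Qed.


(** By convexity the successive decrements do not increase, and the initial one is e E(f). *)
Lemma moment_lower n f : ip F f f - n%:R * (e * En F f) <= q n f.
Proof.
have step k : q k.+1 f - q k.+2 f <= q k f - q k.+1 f.
  have := moment_quad k 1 (-1) f; lra.
have d k : q k f - q k.+1 f <= e * En F f.
  elim: k => [|k]; last exact: le_trans.
  by rewrite /q /= ip_plazyB opprB addrC subrK.
elim: n => [|n IH]; first by rewrite mul0r subr0.
rewrite -natr1 mulrDl mul1r; have := d n; lra.
Qed.

Lemma moment_log_convex n f : q n.+1 f ^+ 2 <= q n f * q n.+2 f.
Proof.
by apply: quad_form_discr => a b; exact: moment_quad.
Qed.

Lemma moment_upper r m f :
  0 < q m f -> q m.+1 f <= r * q m f -> q m f <= r ^+ m * q 0 f.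
Proof.
elim: m => [|m IH] qm qm1; first by rewrite mul1r.
have lc := moment_log_convex m f.
have q0 : 0 < q m f.
  rewrite lt_neqAle moment_ge0 andbT eq_sym; apply/eqP => q0.
  by move: lc; rewrite q0 mul0r leNgt exprn_gt0.
have le1 : q m.+1 f <= r * q m f.
  rewrite -(ler_pM2r qm) -expr2 (le_trans lc)//.
  by have := ler_wpM2l (ltW q0) qm1; lra.
have r0 : 0 <= r.
  by rewrite -(pmulr_lge0 _ q0) (le_trans _ le1)// ltW.
by rewrite (le_trans le1)// exprS -mulrA ler_wpM2l// IH.
Qed.

(* The ratios of successive moments increase, so the decay rate at the final
   time bounds the decay over the whole time interval. *)
Lemma plazy_decay (k : R) n f (g := iter n (plazy e F) f) :
  k * ip F g g <= En F g -> ip F g g <= (1 - e * k) ^+ (n + n) * ip F f f.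
Proof.
have -> : ip F g g = q (n + n) f by exact: momentDl.
have := moment_ge0 (n + n) f; rewrite le_eqVlt => /orP[/eqP<- _|q0 Eg].
  (* The exponent is even, so the right-hand side is nonnegative whatever the sign of 1 - e * k. *)
  by rewrite mulr_ge0 ?ip_ge0// addnn exprn_even_ge0 ?odd_double.
apply: moment_upper => //.
have -> : q (n + n).+1 f = q (n + n) f - e * En F g.
  rewrite -[q (n + n) f]momentDl -ip_plazyB.
  by rewrite -[plazy e F g]/(iter n.+1 (plazy e F) f) momentDl.
have := ler_wpM2l e_ge0 Eg; lra.
Qed.

End Moments.

(** * Restriction to subsets, l^1 contraction, truncation *)

Lemma ip_filter (p : pred V) F f g :
  ip [seq x <- F | p x] f g = ip F f (fun x => (p x)%:R * g x).
Proof.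
rewrite /ip big_filter big_mkcond; apply: eq_bigr => x _.
by case: (p x) => /=; ring.
Qed.

Lemma papp_filter (p : pred V) F f x :
  papp [seq y <- F | p y] f x = papp F (fun y => (p y)%:R * f y) x.
Proof.
rewrite /papp big_filter big_mkcond; apply: eq_bigr => y _.
by case: (p y) => /=; ring.
Qed.

Lemma En_filter (p : pred V) F f :
  En [seq x <- F | p x] f = En F (fun x => (p x)%:R * f x).
Proof.
rewrite /En !ip_filter; congr (_ - _).
  by apply: eq_bigr => x _; case: (p x) => /=; ring.
by apply: eq_ip => // x _; exact: papp_filter.
Qed.

Lemma En_split (p : pred V) F f :
  {in F &, forall x y, p x -> ~~ p y -> P x y = 0} ->
  En F f = En [seq x <- F | p x] f + En [seq x <- F | ~~ p x] f.
Proof.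
move=> Pp.
have Pp' : {in F &, forall x y, ~~ p x -> p y -> P x y = 0}.
  move=> x y xF yF px py; have := piP_sym x y.
  rewrite (Pp y x)// mulr0 => /eqP; rewrite mulf_eq0 gt_eqF//= => /eqP//.
rewrite /En addrACA -opprD /ip !big_filter; congr (_ - _); first exact: bigID.
rewrite (bigID p) /=; congr (_ + _); rewrite big_seq_cond [RHS]big_seq_cond;
  apply: eq_bigr => x /andP[xF px]; congr (_ * _ * _);
  rewrite papp_filter; apply: eq_big_seq => y yF;
  have [py|py] := boolP (p y); rewrite /= ?mul1r ?mul0r ?mulr0//.
- by rewrite Pp ?mul0r.
- by rewrite Pp' ?mul0r.
Qed.

Lemma plazy_ge0 e F f : 0 <= e <= 1 -> (forall x, 0 <= f x) ->
  forall x, 0 <= plazy e F f x.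
Proof.
move=> /andP[e0 e1] f0 x; apply: addr_ge0; apply: mulr_ge0 => //.
  by rewrite subr_ge0.
by apply: sumr_ge0 => y _; exact: mulr_ge0.
Qed.

Lemma iter_plazy_ge0 n e F f : 0 <= e <= 1 -> (forall x, 0 <= f x) ->
  forall x, 0 <= iter n (plazy e F) f x.
Proof. by move=> e01 f0; elim: n => //= n IH; exact: plazy_ge0. Qed.

(** Reversibility turns the pi-weighted column sums of P into row sums, which are at most 1. *)
Lemma plazy_l1 e F f : uniq F -> 0 <= e <= 1 -> (forall x, 0 <= f x) ->
  \sum_(x <- F) pi x * plazy e F f x <= \sum_(x <- F) pi x * f x.
Proof.
move=> uF /andP[e0 e1] f0.
have h : \sum_(x <- F) pi x * papp F f x <= \sum_(x <- F) pi x * f x.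
  rewrite (_ : \sum_(x <- F) pi x * papp F f x =
    \sum_(x <- F) pi x * f x * \sum_(y <- F) P x y).
    apply: ler_sum => x _; rewrite -[leRHS]mulr1 ler_wpM2l ?row_le1//.
    by apply: mulr_ge0 => //; exact: ltW.
  under eq_bigr do rewrite mulr_sumr.
  under [RHS]eq_bigr do rewrite mulr_sumr.
  rewrite exchange_big; apply: eq_bigr => x _; apply: eq_bigr => y _ /=.
  by rewrite mulrA piP_sym mulrAC.
under eq_bigr do rewrite mulrDr ![pi _ * (_ * _)]mulrCA.
rewrite big_split /= -!mulr_sumr; have := ler_wpM2l e0 h; lra.
Qed.

Lemma iter_plazy_l1 n e F f : uniq F -> 0 <= e <= 1 -> (forall x, 0 <= f x) ->
  \sum_(x <- F) pi x * iter n (plazy e F) f x <= \sum_(x <- F) pi x * f x.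
Proof.
move=> uF e01 f0; elim: n => //= n; apply: le_trans.
by apply: plazy_l1 => //; exact: iter_plazy_ge0.
Qed.

Lemma markov_mass F g s : 0 < s -> (forall x, 0 <= g x) ->
  \sum_(x <- F | s < g x) pi x <= (\sum_(x <- F) pi x * g x) / s.
Proof.
move=> s0 g0; rewrite ler_pdivlMr// mulr_suml big_mkcond /=.
apply: ler_sum => x _; case: ifP => [sg|_]; last by rewrite mulr_ge0// ltW.
by rewrite ler_pM2l// ltW.
Qed.

(** Truncation to (g - s)_+ is a contraction, so it does not raise the energy, and g^2 - 2 s g <=
    ((g - s)_+)^2 shows that at this level s it costs at most half of the squared norm. *)
Lemma level_energy (lam s : R) F g : uniq F -> 0 <= lam -> 0 <= s ->
  (forall x, 0 <= g x) ->
  4 * s * (\sum_(x <- F) pi x * g x) <= ip F g g ->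
  (forall k, (forall x, 0 <= k x) -> (forall x, g x <= s -> k x = 0) ->
    lam * ip F k k <= En F k) ->
  lam / 2 * ip F g g <= En F g.
Proof.
move=> uF lam0 s0 g0 gs Elam.
pose k x := Num.max (g x - s) 0.
have : lam * ip F k k <= En F k.
  apply: Elam => x; first by rewrite le_max lexx orbT.
  by move=> gxs; apply/max_idPr; rewrite subr_le0.
have kg : En F k <= En F g.
  apply: En_contr => // [x|x y]; rewrite /k.
    have := g0 x; case: (lerP (g x - s) 0) => h; rewrite ?expr0n /= ?sqr_ge0//.
    by nra.
  case: (lerP (g x - s) 0) => hx; case: (lerP (g y - s) 0) => hy;
    rewrite ?subr0 ?sub0r ?oppr0 ?expr0n /= ?sqr_ge0//.
  - by rewrite -[leRHS]sqrrN; apply: sqr_le_sqr; lra.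
  - by apply: sqr_le_sqr; lra.
  - by rewrite opprB addrA subrK.
move/le_trans => /(_ _ kg); apply: le_trans.
rewrite -mulrA ler_wpM2l//.
have : ip F g g - 2 * s * (\sum_(x <- F) pi x * g x) <= ip F k k.
  rewrite /ip mulr_sumr -sumrB; apply: ler_sum => x _.
  rewrite (_ : _ - _ = pi x * (g x ^+ 2 - 2 * s * g x)); last by ring.
  rewrite -[leRHS]mulrA -[k x * _]expr2 ler_pM2l// /k; case: (lerP (g x - s) 0) => h.
    by rewrite expr0n/=; have := g0 x; nra.
  by nra.
lra.
Qed.

(** The norm of a symmetric operator is read off its quadratic form by polarization: the forms at a
    f + h and a f - h with h = P f give 2 a |h|^2 <= m (a^2 |f|^2 + |h|^2), and a = m is taken. As P
    >= 0, replacing g by |g| reduces the test functions to nonnegative ones. *)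
Lemma papp_sq_le (m : R) F f : 0 <= m ->
  (forall g, (forall x, 0 <= g x) -> ip F (papp F g) g <= m * ip F g g) ->
  ip F (papp F f) (papp F f) <= m ^+ 2 * ip F f f.
Proof.
move=> m0 Hm.
have ab g : `|ip F (papp F g) g| <= m * ip F g g.
  have -> : ip F g g = ip F (fun x => `|g x|) (fun x => `|g x|).
    by apply: eq_bigr => x _; rewrite -!mulrA -!expr2 real_normK ?num_real.
  apply: le_trans (Hm _ (fun x => normr_ge0 _)).
  rewrite !ip_pappE (le_trans (ler_norm_sum _ _ _))//.
  apply: ler_sum => x _; rewrite (le_trans (ler_norm_sum _ _ _))//.
  apply: ler_sum => y _; rewrite normrM [`|pi x * _|]ger0_norm ?normrM//.
  by apply: mulr_ge0 => //; exact: ltW.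
pose h := papp F f.
have key a : 2 * a * ip F h h <= m * (a ^+ 2 * ip F f f + ip F h h).
  have ex b c : ip F (papp F (fun x => b * f x + c * h x))
        (fun x => b * f x + c * h x) = b ^+ 2 * ip F h f +
        2 * b * c * ip F h h + c ^+ 2 * ip F (papp F h) h.
    rewrite (eq_ip (fun x _ => papp_lin F b c f h x) (fun _ _ => erefl)).
    rewrite -/h ip_lin (ipC F h) ip_lin (ipC F (papp F h) (fun x => _)) ip_lin.
    rewrite -(ip_papp_sym F f h) -/h (ipC F f h) (ipC F h (papp F h)); ring.
  have ex2 b c : ip F (fun x => b * f x + c * h x)
        (fun x => b * f x + c * h x) = b ^+ 2 * ip F f f +
        2 * b * c * ip F f h + c ^+ 2 * ip F h h.
    set g := (fun x => _); have gE u : ip F g u = b * ip F f u + c * ip F h u.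
      exact: ip_lin.
    by rewrite gE (ipC F f g) (ipC F h g) !gE (ipC F h f); ring.
  have := ab (fun x => a * f x + 1 * h x).
  have := ab (fun x => a * f x + -1 * h x).
  rewrite !ex !ex2 !ler_norml => /andP[h1 _] /andP[_ h2]; lra.
rewrite -/h; move: m0; rewrite le_eqVlt => /orP[/eqP m0|m0].
  by have := key 1; rewrite -m0; have := ip_ge0 F f; nra.
by rewrite -(ler_pM2l m0); have := key m; lra.
Qed.

End FiniteForms.

(** * Dyadic slices *)

Section Dyadic.
Variable R : archiRealFieldType.

(** The part of a between the heights s and 2s, lowered to start at 0; for a >= 0 the slices at s,
    2s, 4s, ... add up to (a - s)_+. *)
Definition slice (s a : R) : R := Num.min (Num.max (a - s) 0) s.

Lemma slice_ge0 s a : 0 < s -> 0 <= slice s a.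
Proof. by move=> s0; rewrite le_min le_max lexx orbT ltW. Qed.

Lemma slice_le s a : slice s a <= s.
Proof. by rewrite ge_min lexx orbT. Qed.

Lemma slice_eq0 s a : 0 < s -> a <= s -> slice s a = 0.
Proof.
move=> s0 sa; rewrite /slice.
have -> : Num.max (a - s) 0 = 0 by apply/max_idPr; rewrite subr_le0.
by apply/min_idPl; exact: ltW.
Qed.

Lemma slice_eq s a : 0 < s -> 2 * s < a -> slice s a = s.
Proof. by move=> s0 sa; apply/min_idPr; rewrite le_max; lra. Qed.

(** Slices are monotone in a, so for b <= a their increments are nonnegative with sum at most a - b;
    the sum of their squares is at most the square of their sum. *)
Lemma sum_slice_sq_le n s a b : 0 < s ->
  \sum_(k < n) (slice (s * 2 ^+ k) a - slice (s * 2 ^+ k) b) ^+ 2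
    <= (a - b) ^+ 2.
Proof.
move=> s0; wlog ba : a b / b <= a.
  move=> H; have [/H//|/ltW/H ab] := leP b a.
  by under eq_bigr do rewrite -sqrrN opprB; rewrite -[leRHS]sqrrN opprB.
(* The claim is strengthened to (x - s)_+ because (x - s)_+ = slice s x + (x - 2s)_+ carries the
   induction from s to 2s. *)
pose m s x := Num.max (x - s) 0 : R.
suff H : \sum_(k < n) (slice (s * 2 ^+ k) a - slice (s * 2 ^+ k) b) ^+ 2
    <= (m s a - m s b) ^+ 2.
  apply: (le_trans H); apply: sqr_le_sqr; rewrite /m;
  case: (lerP (a - s) 0) => h1; case: (lerP (b - s) 0) => h2; lra.
elim: n s s0 => [|n IH] s s0; first by rewrite big_ord0 sqr_ge0.
rewrite big_ord_recl /= mulr1.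
have mE x : m s x = slice s x + m (s * 2) x.
  rewrite /slice /m; case: (lerP (x - s) 0) => h1.
    rewrite (min_idPl _) ?ltW// add0r; apply/esym/max_idPr; lra.
  case: (lerP (x - s) s) => h2; case: (lerP (x - s * 2) 0) => h3; lra.
have := IH (s * 2) (mulr_gt0 s0 (ltr0n _ 2)).
rewrite (eq_bigr (fun k : 'I_n => (slice (s * 2 ^+ bump 0 k) a
   - slice (s * 2 ^+ bump 0 k) b) ^+ 2)); last first.
  by move=> k _; rewrite /bump add1n [2 ^+ _.+1]exprS mulrA.
move=> /(lerD (lexx ((slice s a - slice s b) ^+ 2)))/le_trans; apply.
rewrite !mE -subr_ge0.
have h1 : slice s b <= slice s a.
  by rewrite le_min !ge_min lexx orbT ge_max !le_max lerB// lexx !orbT.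
have h2 : m (s * 2) b <= m (s * 2) a.
  by rewrite ge_max !le_max lerB// lexx orbT.
rewrite (_ : _ - _ = 2 * ((slice s a - slice s b) *
  (m (s * 2) a - m (s * 2) b))); last by ring.
by rewrite !mulr_ge0 ?subr_ge0// ler0n.
Qed.

(** The constants are sharp: for a = s 2^(j+1), with j < n, the geometric sum gives s^2 (4^(j+1) -
    7) exactly. In the induction from 2s, the new term 24 * 7/8 = 21 turns the error 7 * 4 back into
    7. *)
Lemma dyadic_level n (s a : R) : 0 < s -> 0 <= a -> a <= s * 2 ^+ n ->
  a ^+ 2 - 7 * s ^+ 2 <= 24 * \sum_(k < n) (s * 2 ^+ k) ^+ 2 *
    ((2 * (s * 2 ^+ k) < a)%R%:R - (s * 2 ^+ k < a)%R%:R / 8).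
Proof.
move=> + a0; elim: n s => [|n IH] s s0 an.
  by rewrite big_ord0 mulr0; nra.
rewrite big_ord_recl /= mulr1.
have e : \sum_(i < n) (s * 2 ^+ bump 0 i) ^+ 2 *
    ((2 * (s * 2 ^+ bump 0 i) < a)%R%:R - (s * 2 ^+ bump 0 i < a)%R%:R / 8) =
  \sum_(k < n) (s * 2 * 2 ^+ k) ^+ 2 *
    ((2 * (s * 2 * 2 ^+ k) < a)%R%:R - (s * 2 * 2 ^+ k < a)%R%:R / 8).
  by apply: eq_bigr => k _; rewrite /bump add1n [2 ^+ _.+1]exprS mulrA.
rewrite e {e}.
have z : a <= 2 * s -> \sum_(k < n) (s * 2 * 2 ^+ k) ^+ 2 *
    ((2 * (s * 2 * 2 ^+ k) < a)%R%:R - (s * 2 * 2 ^+ k < a)%R%:R / 8) = 0.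
  move=> a2; apply: big1 => k _.
  have p1 : 1 <= 2 ^+ k :> R by rewrite exprn_ege1// ler1n.
  have p2 : s * 2 <= s * 2 * 2 ^+ k by rewrite ler_peMr// mulr_ge0// ltW.
  have q1 : a <= s * 2 * 2 ^+ k by lra.
  have q2 : a <= 2 * (s * 2 * 2 ^+ k) by lra.
  by rewrite !ltNge q1 q2 /= mul0r subr0 mulr0.
have [as1|as1] := leP a s.
  rewrite z; last lra.
  by rewrite (_ : (_ < a) = false) ?mul0r ?subr0 ?mulr0 ?addr0; nra.
have [as2|as2] := leP a (2 * s).
  by rewrite z//=; nra.
have := IH (s * 2) (mulr_gt0 s0 (ltr0n _ 2)).
rewrite -mulrA -exprS => /(_ an).
by set S := \sum_(k < n) _; rewrite /=; lra.
Qed.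

End Dyadic.

Section DyadicEnergy.
Variables (R : archiRealFieldType) (V : eqType).
Variables (P : V -> V -> R) (pi : V -> R).
Hypothesis P_ge0 : forall x y, 0 <= P x y.
Hypothesis pi_gt0 : forall x, 0 < pi x.
Hypothesis piP_sym : forall x y, pi x * P x y = pi y * P y x.
Hypothesis row_le1 : forall (F : seq V) x, uniq F -> \sum_(y <- F) P x y <= 1.

Lemma expn2_bound (F : seq V) (f : V -> R) (s : R) : 0 < s ->
  exists n, {in F, forall x, f x <= s * 2 ^+ n}.
Proof.
move=> s0; elim: F => [|x F [n Hn]]; first by exists 0.
pose m := Num.bound (f x / s).
have Hm : f x <= s * 2 ^+ m.
  rewrite mulrC -ler_pdivrMr//.
  have [h|h] := leP 0 (f x / s); last first.
    by rewrite (le_trans (ltW h))// exprn_ge0.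
  rewrite (le_trans (ltW (archi_boundP h)))// -natrX ler_nat.
  exact/ltnW/ltn_expl.
have le2 i j : (i <= j)%N -> s * 2 ^+ i <= s * 2 ^+ j.
  by move=> ij; rewrite ler_pM2l// ler_weXn2l// ler1n.
exists (maxn m n) => y; rewrite inE => /orP[/eqP->|/Hn h].
  exact: le_trans Hm (le2 _ _ (leq_maxl _ _)).
exact: le_trans h (le2 _ _ (leq_maxr _ _)).
Qed.

(* Splitting f into the pieces of heights between s and 2s, over dyadic s,
   loses only a constant factor in the squared norm and nothing in energy. *)
Lemma dyadic_energy (t : R) F f : uniq F -> 0 <= t -> (forall x, 0 <= f x) ->
  (forall s, 0 < s ->
     16^-1 * (s ^+ 2 * \sum_(x <- F) pi x *
       ((2 * s < f x)%R%:R - (s < f x)%R%:R / 8))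
     <= t * En P pi F (fun x => slice s (f x))) ->
  ip pi F f f <= 2 ^+ 9 * (t * En P pi F f).
Proof.
move=> uF t0 f0 H; set X := 2 ^+ 9 * _.
pose M := \sum_(x <- F) pi x.
have M0 : 0 <= M by apply: sumr_ge0 => x _; exact: ltW.
(* Starting the slices at height s costs at most 7 s^2 M; afterwards s is made small. *)
have key s : 0 < s -> ip pi F f f - 7 * s ^+ 2 * M <= X.
  move=> s0; have [n Hn] := expn2_bound F f s0.
  apply: (@le_trans _ _ (24 * \sum_(k < n) (s * 2 ^+ k) ^+ 2 *
    \sum_(x <- F) pi x *
       ((2 * (s * 2 ^+ k) < f x)%R%:R - (s * 2 ^+ k < f x)%R%:R / 8))).
    under [X in _ <= _ * X]eq_bigr do rewrite mulr_sumr.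
    rewrite exchange_big /= mulr_sumr mulr_sumr -sumrB big_seq [leRHS]big_seq.
    apply: ler_sum => x xF.
    rewrite (_ : _ - _ = pi x * (f x ^+ 2 - 7 * s ^+ 2)); last by ring.
    under [X in _ <= _ * X]eq_bigr do rewrite mulrCA.
    rewrite -mulr_sumr [leRHS]mulrCA ler_pM2l//; apply: dyadic_level => //.
    exact: Hn.
  have h1 : \sum_(k < n) En P pi F (fun x => slice (s * 2 ^+ k) (f x))
      <= En P pi F f.
    apply: sum_En_le => // [x|x y]; last exact: sum_slice_sq_le.
    rewrite -[X in _ <= X ^+ 2]subr0.
    apply: le_trans (sum_slice_sq_le n (f x) 0 s0).
    apply: ler_sum => k _; have p : 0 < s * 2 ^+ k by rewrite mulr_gt0 ?exprn_gt0.
    by rewrite [slice _ 0]slice_eq0 ?subr0// ltW.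
  have h2 : 16^-1 * \sum_(k < n) (s * 2 ^+ k) ^+ 2 *
    \sum_(x <- F) pi x *
       ((2 * (s * 2 ^+ k) < f x)%R%:R - (s * 2 ^+ k < f x)%R%:R / 8)
    <= t * \sum_(k < n) En P pi F (fun x => slice (s * 2 ^+ k) (f x)).
    rewrite !mulr_sumr; apply: ler_sum => k _; apply: H.
    by rewrite mulr_gt0 ?exprn_gt0.
  have h3 := ler_wpM2l t0 h1.
  have h4 : 0 <= t * En P pi F f by apply: mulr_ge0 => //; exact: En_ge0.
  (* The product 24 * 16 = 384 is rounded up to 2^9. *)
  rewrite /X; lra.
rewrite leNgt; apply/negP => Xlt.
(* This d is at most 1 and satisfies 8 M d < |f|^2 - X, so that 7 d^2 M stays below the gap; M + 1
   allows for M = 0. *)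
pose d := (ip pi F f f - X) / (8 * (M + 1) * (1 + (ip pi F f f - X))).
have d0 : 0 < ip pi F f f - X by rewrite subr_gt0.
have dp : 0 < d by rewrite divr_gt0// !mulr_gt0//; lra.
have := key _ dp.
have d1 : d * (8 * (M + 1) * (1 + (ip pi F f f - X))) = ip pi F f f - X.
  by rewrite divfK// !mulf_neq0 ?gt_eqF//; lra.
have d2 : d <= 1.
  rewrite ler_pdivrMr ?mul1r ?mulr_gt0//; try lra.
  nra.
have d3 : d * (8 * M) < ip pi F f f - X.
  rewrite -d1 ltr_pM2l//; nra.
have d4 : d ^+ 2 * (8 * M) <= d * (8 * M).
  rewrite ler_wpM2r ?mulr_ge0//; nra.
lra.
Qed.

End DyadicEnergy.

(** * Sums over a countable set *)

Section RealSums.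
Variables (R : realType) (V : countType).
Implicit Types (f g : V -> R) (s : seq V).

Lemma sum_le_esum f s : uniq s -> (forall x, 0 <= f x) ->
  ((\sum_(x <- s) f x)%:E <= \esum_(x in [set: V]) (f x)%:E)%E.
Proof.
move=> us f0; apply: esum_ge; exists [set` s].
  by split => //; exact: finite_seq.
by rewrite -sumEFin (fsbig_seq _ (fun x => (f x)%:E) us).
Qed.

Lemma esum_le f (M : \bar R) :
  (forall s, uniq s -> ((\sum_(x <- s) f x)%:E <= M)%E) ->
  (\esum_(x in [set: V]) (f x)%:E <= M)%E.
Proof.
move=> H; apply: ge_ereal_sup => _ [X [finX _] <-].
by rewrite fsbig_finite//= sumEFin; apply: H; exact: finmap.fset_uniq.
Qed.

Lemma lt_esum f (c : R) : (c%:E < \esum_(x in [set: V]) (f x)%:E)%E ->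
  exists2 s, uniq s & c < \sum_(x <- s) f x.
Proof.
move=> /ereal_sup_gt[_ [X [finX _] <-]].
rewrite fsbig_finite//= sumEFin lte_fin => h.
by exists (finmap.enum_fset (fset_set X)) => //; exact: finmap.fset_uniq.
Qed.

Lemma ler_sum_sub f s r : uniq s -> uniq r -> {subset s <= r} ->
  (forall x, 0 <= f x) -> \sum_(x <- s) f x <= \sum_(x <- r) f x.
Proof.
move=> us ur sr f0; rewrite [leRHS](bigID (mem s)) /= ler_wpDr ?sumr_ge0//.
rewrite -[leRHS]big_filter le_eqVlt; apply/orP; left; apply/eqP.
apply: perm_big; apply: uniq_perm; rewrite ?filter_uniq// => x.
by rewrite mem_filter /=; case: (boolP (x \in s)) => // /sr ->.
Qed.

Lemma esum_support f s : uniq s -> (forall x, 0 <= f x) ->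
  (forall x, x \notin s -> f x = 0) ->
  \esum_(x in [set: V]) (f x)%:E = (\sum_(x <- s) f x)%:E.
Proof.
move=> us f0 fs; apply/eqP; rewrite eq_le sum_le_esum// andbT.
apply: esum_le => r ur; rewrite lee_fin.
rewrite [leLHS](bigID (mem s)) /= [X in _ + X]big1 ?addr0; last first.
  by move=> x /fs.
rewrite -big_filter; apply: ler_sum_sub => //; first exact: filter_uniq.
by move=> x; rewrite mem_filter => /andP[].
Qed.

Definition abs_summable f :=
  exists M : R, forall s, uniq s -> \sum_(x <- s) `|f x| <= M.

Lemma abs_summable_le f g : (forall x, `|f x| <= `|g x|) ->
  abs_summable g -> abs_summable f.
Proof.
move=> fg [M HM]; exists M => s /HM; apply: le_trans.
by apply: ler_sum => x _.
Qed.

Lemma abs_summable_esum f : (forall x, 0 <= f x) -> abs_summable f ->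
  \esum_(x in [set: V]) (f x)%:E \is a fin_num.
Proof.
move=> f0 [M HM]; rewrite ge0_fin_numE ?esum_ge0//; last first.
  by move=> x _; rewrite lee_fin.
apply: (@le_lt_trans _ _ M%:E); last exact: ltry.
apply: esum_le => s /HM; rewrite lee_fin.
by under eq_bigr do rewrite ger0_norm//.
Qed.

Lemma abs_summableP f M : (forall x, 0 <= f x) ->
  (\esum_(x in [set: V]) (f x)%:E <= M%:E)%E -> abs_summable f.
Proof.
move=> f0 H; exists M => s us; rewrite -lee_fin.
apply: le_trans H; under eq_bigr do rewrite ger0_norm//.
exact: sum_le_esum.
Qed.

(** An exhaustion of V by finite lists, which makes unordered sums limits of sequences; every finite
    list is eventually contained in it. *)
Definition enumV (n : nat) : seq V := pmap pickle_inv (iota 0 n).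

Lemma enumV_uniq n : uniq (enumV n).
Proof. by apply: (pmap_uniq (@pickle_invK V)); exact: iota_uniq. Qed.

Lemma mem_enumV n x : (x \in enumV n) = (pickle x < n)%N.
Proof.
rewrite mem_pmap; apply/mapP/idP => [[i]|xn].
  rewrite mem_iota add0n /= => ilt xi.
  by have := @pickle_invK V i; rewrite -xi /= => ->.
by exists (pickle x); [rewrite mem_iota add0n|rewrite pickleK_inv].
Qed.

Lemma sub_enumV s : \forall n \near \oo, {subset s <= enumV n}.
Proof.
exists (\max_(x <- s) pickle x).+1 => // n /= sn x xs.
rewrite mem_enumV (leq_trans _ sn)// ltnS.
by apply: leq_bigmax_seq.
Qed.

Lemma cvg_enum_ge0 f : (forall x, 0 <= f x) -> abs_summable f ->
  \sum_(x <- enumV n) f x @[n --> \oo] -->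
    fine (\esum_(x in [set: V]) (f x)%:E).
Proof.
move=> f0 sf; have fin := abs_summable_esum f0 sf.
apply/cvgrPdist_le => e e0.
have : ((fine (\esum_(x in [set: V]) (f x)%:E) - e)%:E
    < \esum_(x in [set: V]) (f x)%:E)%E.
  by rewrite -[ltRHS]fineK// lte_fin ltrBlDr ltrDl.
move=> /lt_esum[s us lts].
near=> n.
have sn : {subset s <= enumV n} by near: n; exact: sub_enumV.
have h1 := ler_sum_sub us (enumV_uniq n) sn f0.
have h2 : \sum_(x <- enumV n) f x <= fine (\esum_(x in [set: V]) (f x)%:E).
  by rewrite -lee_fin fineK// sum_le_esum// enumV_uniq.
rewrite ger0_norm ?subr_ge0//; lra.
Unshelve. all: by end_near. Qed.

Lemma cvg_enum f : abs_summable f ->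
  \sum_(x <- enumV n) f x @[n --> \oo] --> vsum f.
Proof.
move=> sf.
have pos_neg x : f^\+ x - f^\- x = f x.
  by rewrite -[RHS](congr1 (fun h => h x) (funrposBneg f)).
have norm_f x : f^\+ x + f^\- x = `|f x|.
  exact: (congr1 (fun h => h x) (funrposDneg f)).
have e n : \sum_(x <- enumV n) f^\+ x - \sum_(x <- enumV n) f^\- x =
    \sum_(x <- enumV n) f x.
  by rewrite -sumrB; apply: eq_bigr => x _; exact: pos_neg.
rewrite -(eq_cvg _ _ e); apply: cvgB; apply: cvg_enum_ge0 => //.
  by apply: abs_summable_le sf => x; rewrite ger0_norm// -norm_f lerDl.
by apply: abs_summable_le sf => x; rewrite ger0_norm// -norm_f lerDr.
Qed.

End RealSums.

Lemma cvg_sum_seq (R : realType) (I : Type) (s : seq I) (f : nat -> I -> R)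
    (l : I -> R) : (forall i, f n i @[n --> \oo] --> l i) ->
  \sum_(i <- s) f n i @[n --> \oo] --> \sum_(i <- s) l i.
Proof.
move=> fl; elim: s => [|i s IH].
  by rewrite big_nil; under eq_cvg do rewrite big_nil; exact: cvg_cst.
by rewrite big_cons; under eq_cvg do rewrite big_cons; exact: cvgD.
Qed.

Section VsumTheory.
Variables (R : realType) (V : countType).
Implicit Types (f g : V -> R) (s : seq V).

Lemma vsum_lim f l : abs_summable f ->
  \sum_(x <- enumV V n) f x @[n --> \oo] --> l -> vsum f = l.
Proof. by move=> /cvg_enum fv fl; exact: (cvg_unique _ fv fl). Qed.

Lemma abs_summable_lin a b f g : abs_summable f -> abs_summable g ->
  abs_summable (fun x => a * f x + b * g x).
Proof.
move=> [M HM] [N HN]; exists (`|a| * M + `|b| * N) => s us.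
apply: (@le_trans _ _ (\sum_(x <- s) (`|a| * `|f x| + `|b| * `|g x|))).
  by apply: ler_sum => x _; rewrite -!normrM ler_normD.
rewrite big_split -!mulr_sumr /=; apply: lerD; apply: ler_wpM2l => //.
  exact: HM.
exact: HN.
Qed.

Lemma vsum_lin a b f g : abs_summable f -> abs_summable g ->
  vsum (fun x => a * f x + b * g x) = a * vsum f + b * vsum g.
Proof.
move=> sf sg; apply: vsum_lim; first exact: abs_summable_lin.
under eq_cvg do rewrite big_split /= -!mulr_sumr.
by apply: cvgD; apply: cvgMl_tmp; exact: cvg_enum.
Qed.

Lemma vsum_norm_le f M : (forall s, uniq s -> \sum_(x <- s) `|f x| <= M) ->
  `|vsum f| <= M.
Proof.
move=> HM; have sf : abs_summable f by exists M.
apply: (@cvgr_to_le _ _ _ _ _ _ _ (cvg_norm (cvg_enum sf))).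
apply: nearW => n; apply: (le_trans (ler_norm_sum _ _ _)).
exact/HM/enumV_uniq.
Qed.

Lemma abs_summable_support f s : uniq s -> (forall x, x \notin s -> f x = 0) ->
  abs_summable f.
Proof.
move=> us fs; exists (\sum_(x <- s) `|f x|) => r ur.
rewrite (bigID (mem s)) /= [X in _ + X]big1 ?addr0; last first.
  by move=> x /fs ->; rewrite normr0.
rewrite -big_filter; apply: ler_sum_sub => //; first exact: filter_uniq.
by move=> x; rewrite mem_filter => /andP[].
Qed.

Lemma vsum_support f s : uniq s -> (forall x, x \notin s -> f x = 0) ->
  vsum f = \sum_(x <- s) f x.
Proof.
move=> us fs; apply: vsum_lim; first exact: abs_summable_support fs.
apply: cvg_near_cst; near=> n.
have sn : {subset s <= enumV V n} by near: n; exact: sub_enumV.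
rewrite (bigID (mem s)) /= [X in _ + X]big1 ?addr0//.
rewrite -big_filter; apply: perm_big; apply: uniq_perm => //.
  by rewrite filter_uniq// enumV_uniq.
by move=> x; rewrite mem_filter /=; case: (boolP (x \in s)) => // /sn ->.
Unshelve. all: by end_near. Qed.

Lemma sum_le_vsum f s : uniq s -> (forall x, 0 <= f x) -> abs_summable f ->
  \sum_(x <- s) f x <= vsum f.
Proof.
move=> us f0 sf; apply: ler_cvg_to (cvg_cst _) (cvg_enum sf) _.
near=> n; apply: ler_sum_sub => //; first exact: enumV_uniq.
by near: n; exact: sub_enumV.
Unshelve. all: by end_near. Qed.

End VsumTheory.

(** * Compound powers and the heat kernel *)

Section ScalarExp.
Variable R : realType.

Lemma bernoulli_sub (y : R) n : 0 <= y <= 1 -> 1 - n%:R * y <= (1 - y) ^+ n.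
Proof.
move=> /andP[y0 y1]; elim: n => [|n IH]; first by rewrite mul0r subr0.
rewrite exprS -natr1; have h : 0 <= 1 - y by rewrite subr_ge0.
have := ler_wpM2l h IH; have : 0 <= n%:R :> R by [].
nra.
Qed.

(** With x = s / n, the inequality e^x (1 - x) <= 1 gives e^x (1 - x^2) <= 1 + x <= e^x. Raised to
    the power n, with Bernoulli on the left, this squeezes the power between e^s (1 - s^2 / n) and
    e^s. *)
Lemma cvg_expR_compound (s : R) : 0 <= s ->
  (1 + s / n%:R) ^+ n @[n --> \oo] --> expR s.
Proof.
move=> s0.
apply: (@squeeze_cvgr _ _ _ _
  (fun n => expR s * (1 - s ^+ 2 / n%:R)) (fun _ => expR s)); last 2 first.
- rewrite -[X in _ --> X]mulr1 -[X in _ * X]subr0.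
  apply: cvgMl_tmp; apply: cvgB; first exact: cvg_cst.
  rewrite -[X in _ --> X](mulr0 (s ^+ 2)); apply: cvgMl_tmp.
  by rewrite -cvg_shiftS; exact: cvg_harmonic.
- exact: cvg_cst.
near=> n.
have n0 : (0 < n)%N by near: n; exact: nbhs_infty_gt.
have nR : 0 < n%:R :> R by rewrite ltr0n.
have sn : s <= n%:R by near: n; exact: nbhs_infty_ger.
set x := s / n%:R.
have x0 : 0 <= x by rewrite divr_ge0.
have x1 : x <= 1 by rewrite ler_pdivrMr ?mul1r.
have es : expR s = expR x ^+ n by rewrite -expRM_natl mulrC divfK ?gt_eqF.
rewrite es; apply/andP; split; last first.
  by rewrite lerXn2r ?nnegrE ?expR_ge0 ?expR_ge1Dx// addr_ge0.
have -> : s ^+ 2 / n%:R = n%:R * x ^+ 2.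
  by rewrite /x; field; rewrite gt_eqF.
apply: (@le_trans _ _ (expR x ^+ n * (1 - x ^+ 2) ^+ n)).
  rewrite ler_wpM2l ?exprn_ge0 ?expR_ge0// bernoulli_sub// sqr_ge0 /=.
  by rewrite expr_le1.
rewrite -exprMn lerXn2r ?nnegrE ?mulr_ge0 ?expR_ge0 ?subr_ge0 ?expr_le1//.
  by rewrite addr_ge0.
have h : expR x * (1 - x) <= 1.
  by rewrite -[leRHS](expRxMexpNx_1 x) ler_wpM2l ?expR_ge0// expR_ge1Dx.
have := ler_wpM2l (_ : 0 <= 1 + x) h; rewrite addr_ge0// => /(_ isT).
lra.
Unshelve. all: by end_near. Qed.

Lemma bin_pow_le (N n : nat) : (0 < N)%N ->
  'C(N, n)%:R / N%:R ^+ n <= (n`!%:R)^-1 :> R.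
Proof.
move=> N0; have NR : 0 < N%:R ^+ n :> R by rewrite exprn_gt0// ltr0n.
rewrite ler_pdivrMr// ler_pdivlMl ?ltr0n ?fact_gt0//.
rewrite -natrM -natrX ler_nat mulnC bin_ffact.
elim: n {NR} => [|n IH]; first by rewrite ffactn0.
by rewrite ffactnSr expnSr leq_mul// leq_subr.
Qed.

Lemma sum_exp_coeff_le (s : R) n : 0 <= s ->
  \sum_(k < n) s ^+ k / k`!%:R <= expR s.
Proof.
move=> s0; rewrite -(big_mkord xpredT (fun k => s ^+ k / k`!%:R)).
apply: (nondecreasing_cvgn_le _ (is_cvg_series_exp_coeff s)).
apply/nondecreasing_seqP => k; rewrite /series/= big_nat_recr//= lerDl.
exact: exp_coeff_ge0.
Qed.

(* The coefficients C(N,n) / N^n of the N-th compound power are dominated by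
   1/n!, so the total error is controlled by its scalar instance. *)
Lemma compound_exp_cvg (a : nat -> R) (r : R) : 0 <= r ->
  (forall n, `|a n| <= r ^+ n) ->
  \sum_(n < N.+1) 'C(N, n)%:R / N%:R ^+ n * a n @[N --> \oo] -->
    limn (series (fun n => a n / n`!%:R)).
Proof.
move=> r0 ar; set l := limn _.
have cl : series (fun n => a n / n`!%:R) @ \oo --> l.
  apply: normed_cvg.
  apply: (@series_le_cvg _ _ (exp_coeff r)); last exact: is_cvg_series_exp_coeff.
  - by move=> n /=.
  - by move=> n; rewrite exp_coeff_ge0.
  - move=> n /=; rewrite normrM normfV (ger0_norm (ler0n _ _)).
    by rewrite ler_wpM2r ?invr_ge0 ?ler0n.
have cl' : \sum_(n < N.+1) a n / n`!%:R @[N --> \oo] --> l.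
  move: cl; rewrite -cvg_shiftS; apply: cvg_trans; apply: near_eq_cvg; apply: nearW => N /=.
  by rewrite /series /= big_mkord.
rewrite -[l]subr0.
pose d N := \sum_(n < N.+1) a n / n`!%:R
   - \sum_(n < N.+1) 'C(N, n)%:R / N%:R ^+ n * a n.
have -> : (fun N : nat => \sum_(n < N.+1) 'C(N, n)%:R / N%:R ^+ n * a n) =
   (fun N : nat => \sum_(n < N.+1) a n / n`!%:R - d N).
  by apply/funext => N; rewrite /d opprB addrC subrK.
apply: cvgB => //; apply/norm_cvg0P.
apply: (@squeeze_cvgr _ _ _ _ (fun _ => 0)
  (fun N : nat => expR r - (1 + r / N%:R) ^+ N)); last 2 first.
- exact: cvg_cst.
- rewrite -[X in _ --> X](subrr (expR r)); apply: cvgB; first exact: cvg_cst.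
  exact: cvg_expR_compound.
near=> N; rewrite normr_ge0 /=.
have N0 : (0 < N)%N by near: N; exact: nbhs_infty_gt.
have -> : (1 + r / N%:R) ^+ N =
    \sum_(n < N.+1) 'C(N, n)%:R / N%:R ^+ n * r ^+ n.
  rewrite exprDn; apply: eq_bigr => n _.
  by rewrite expr1n mul1r expr_div_n -mulr_natl; ring.
apply: (@le_trans _ _ (\sum_(n < N.+1) r ^+ n / n`!%:R
    - \sum_(n < N.+1) 'C(N, n)%:R / N%:R ^+ n * r ^+ n)); last first.
  by rewrite lerB// sum_exp_coeff_le.
rewrite /d -!sumrB (le_trans (ler_norm_sum _ _ _))//.
apply: ler_sum => n _.
rewrite [a n / _]mulrC [r ^+ n / _]mulrC -!mulrBl normrM.
rewrite [X in X * _]ger0_norm ?subr_ge0 ?bin_pow_le//.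
by rewrite ler_wpM2l ?ar// subr_ge0 bin_pow_le.
Unshelve. all: by end_near. Qed.

End ScalarExp.

Section HeatKernel.
Variables (R : realType) (V : countType) (P : V -> V -> R).
Hypothesis P_ge0 : forall x y, 0 <= P x y.
Hypothesis row_le1 : forall (F : seq V) x, uniq F -> \sum_(y <- F) P x y <= 1.
Implicit Types (g h : V -> R).

Let bnd M g := forall x, `|g x| <= M.

Lemma row_sum_le M g x s : uniq s -> bnd M g ->
  \sum_(y <- s) `|P x y * g y| <= M.
Proof.
move=> us gM; have M0 : 0 <= M by exact: le_trans (normr_ge0 _) (gM x).
apply: (@le_trans _ _ (\sum_(y <- s) P x y * M)).
  by apply: ler_sum => y _; rewrite normrM ger0_norm// ler_wpM2l.
by rewrite -mulr_suml -[leRHS]mul1r ler_wpM2r// row_le1.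
Qed.

Lemma abs_summable_row M g x : bnd M g -> abs_summable (fun y => P x y * g y).
Proof. by move=> gM; exists M => s us; exact: row_sum_le. Qed.

Lemma kapp_norm_le M g x : bnd M g -> `|kapp P g x| <= M.
Proof. by move=> gM; apply: vsum_norm_le => s us; exact: row_sum_le. Qed.

Lemma kapp_lin M N a b g h x : bnd M g -> bnd N h ->
  kapp P (fun y => a * g y + b * h y) x = a * kapp P g x + b * kapp P h x.
Proof.
move=> gM hN; rewrite /kapp -vsum_lin; [|exact: abs_summable_row gM|
  exact: abs_summable_row hN].
by congr vsum; apply/funext => y; ring.
Qed.

(** The kernel t (P - I) as an operator on bounded functions, of sup norm at most 2t. Kernel powers
    are computed column by column with it, all sums converging absolutely. *)
Definition gen (t : R) g (x : V) : R := t * (kapp P g x - g x).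

Lemma gen_norm_le t M g : 0 <= t -> bnd M g -> bnd (2 * t * M) (gen t g).
Proof.
move=> t0 gM x; rewrite /gen normrM ger0_norm// [2 * t]mulrC -mulrA ler_wpM2l//.
rewrite (le_trans (ler_normB _ _))// mulr_natl mulr2n lerD//.
exact: kapp_norm_le.
Qed.

Lemma iter_gen_norm_le t g n : 0 <= t -> bnd 1 g ->
  bnd ((2 * t) ^+ n) (iter n (gen t) g).
Proof.
move=> t0 g1; elim: n => [//|n IH]; rewrite exprS iterS.
exact: gen_norm_le.
Qed.

Lemma delta_bnd (y : V) : bnd 1 (fun x : V => (x == y)%:R).
Proof. by move=> x; case: (_ == _); rewrite ?normr1 ?normr0. Qed.

Lemma kpow_gen t n (x y : V) : 0 <= t ->
  kpow (fun x y => t * (P x y - kid R x y)) n x y =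
  iter n (gen t) (fun z => (z == y)%:R) x.
Proof.
move=> t0; elim: n x => [//|n IH] x.
rewrite -[LHS]/(vsum (fun z => t * (P x z - kid R x z) *
  kpow (fun x y => t * (P x y - kid R x y)) n z y)) /=.
pose g := iter n (gen t) (fun z => (z == y)%:R); have gb := iter_gen_norm_le n t0 (delta_bnd y).
have sP := abs_summable_row x gb.
have sI : forall z, z \notin [:: x] -> (x == z)%:R * g z = 0.
  by move=> z; rewrite inE eq_sym => /negPf ->; rewrite mul0r.
rewrite (_ : (fun z => _) =
  (fun z => t * (P x z * g z) + (- t) * ((x == z)%:R * g z))); last first.
  by apply/funext => z; rewrite IH /kid -/g; ring.
rewrite vsum_lin//; last exact: (abs_summable_support _ sI).
by rewrite (vsum_support _ sI)// big_seq1 eqxx mul1r /gen /kapp -/g; ring.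
Qed.

Definition lazy (e : R) g (x : V) : R := (1 - e) * g x + e * kapp P g x.

Lemma gen_sum t n (c : nat -> R) (h : nat -> V -> R) (M : nat -> R) x :
  (forall i, bnd (M i) (h i)) ->
  gen t (fun y => \sum_(i < n) c i * h i y) x =
  \sum_(i < n) c i * gen t (h i) x.
Proof.
move=> hM.
have bs m : exists N, bnd N (fun y => \sum_(i < m) c i * h i y).
  exists (\sum_(i < m) `|c i| * M i) => y.
  rewrite (le_trans (ler_norm_sum _ _ _))//; apply: ler_sum => i _.
  by rewrite normrM ler_wpM2l// hM.
elim: n => [|n IH].
  rewrite big_ord0 /gen.
  rewrite big_ord0 subr0 /kapp (@vsum_support _ _ _ [::]) ?big_nil ?mulr0//.
  by move=> y _; rewrite big_ord0 mulr0.
rewrite big_ord_recr /= -IH /gen big_ord_recr /=.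
under eq_fun do rewrite big_ord_recr /= -[X in X + _]mul1r.
have [N bN] := bs n.
rewrite (kapp_lin _ _ _ bN (hM n)); ring.
Qed.

(** [lazy (s * t)] is I + s [gen t], so this is the binomial formula; s = 1/n produces the compound
    coefficients. *)
Lemma iter_lazy_binomial t s n g x : 0 <= t -> bnd 1 g ->
  iter n (lazy (s * t)) g x =
  \sum_(k < n.+1) 'C(n, k)%:R * s ^+ k * iter k (gen t) g x.
Proof.
move=> t0 g1; elim: n x => [|n IH] x.
  by rewrite big_ord_recr big_ord0 /= bin0 !mul1r add0r.
rewrite iterS (_ : iter n _ g =
  (fun x => \sum_(k < n.+1) ('C(n, k)%:R * s ^+ k) * iter k (gen t) g x));
  last exact/funext.
set S := fun x => _.
have -> : lazy (s * t) S x = S x + s * gen t S x by rewrite /lazy /gen; ring.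
rewrite /S (gen_sum t n.+1 (fun k => 'C(n, k)%:R * s ^+ k) x
  (fun i => iter_gen_norm_le i t0 g1)).
rewrite [RHS]big_ord_recl /= bin0 mulr_sumr.
rewrite [X in X + _]big_ord_recl /= bin0 -addrA; congr (_ + _).
have -> : \sum_(i < n) 'C(n, bump 0 i)%:R * s ^+ bump 0 i *
    iter (bump 0 i) (gen t) g x = \sum_(i < n.+1) 'C(n, bump 0 i)%:R *
    s ^+ bump 0 i * iter (bump 0 i) (gen t) g x.
  by rewrite [RHS]big_ord_recr /= [X in 'C(n, X)]/bump add1n bin_small//
    !mul0r addr0.
rewrite -big_split; apply: eq_bigr => i _ /=.
by rewrite /bump add1n binS natrD [s ^+ _.+1]exprS /=; ring.
Qed.

Lemma cvg_iter_lazy_heat t x y : 0 <= t ->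
  iter n (lazy (t / n%:R)) (fun z => (z == y)%:R) x @[n --> \oo] -->
  heat P t x y.
Proof.
move=> t0; rewrite /heat /kexp.
have -> : (fun n : nat => iter n (lazy (t / n%:R)) (fun z => (z == y)%:R) x) =
  (fun n : nat => \sum_(k < n.+1) 'C(n, k)%:R / n%:R ^+ k *
     iter k (gen t) (fun z => (z == y)%:R) x).
  apply/funext => n; rewrite [t / _]mulrC iter_lazy_binomial//; last first.
    exact: delta_bnd.
  by apply: eq_bigr => k _; rewrite exprVn.
have -> : (fun n => kpow (fun x y => t * (P x y - kid R x y)) n x y / n`!%:R) =
   (fun n => iter n (gen t) (fun z => (z == y)%:R) x / n`!%:R).
  by apply/funext => n; rewrite kpow_gen.
apply: (@compound_exp_cvg _ _ (2 * t)); first by rewrite mulr_ge0.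
by move=> n; apply: iter_gen_norm_le => //; exact: delta_bnd.
Qed.

End HeatKernel.

(** * Approximation of the heat kernel by walks killed outside finite sets *)

Section FiniteApproximation.
Variables (R : realType) (V : countType) (P : V -> V -> R).
Hypothesis P_ge0 : forall x y, 0 <= P x y.
Hypothesis row_le1 : forall (F : seq V) x, uniq F -> \sum_(y <- F) P x y <= 1.
Implicit Types (g h : V -> R).

Let unit_fun g := forall x, 0 <= g x <= 1.

Lemma unit_fun_bnd g : unit_fun g -> forall x, `|g x| <= 1.
Proof. by move=> g1 x; have /andP[g0 ?] := g1 x; rewrite ger0_norm. Qed.

Lemma papp_le_kapp F g h x : uniq F -> (forall y, g y <= h y) -> unit_fun h ->
  papp P F g x <= kapp P h x.
Proof.
move=> uF gh h1; apply: (@le_trans _ _ (papp P F h x)).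
  by apply: ler_sum => y _; rewrite ler_wpM2l.
apply: sum_le_vsum => // [y|]; first by rewrite mulr_ge0//; case/andP: (h1 y).
exact: (abs_summable_row P_ge0 row_le1 x (unit_fun_bnd h1)).
Qed.

Lemma lazy_unit e g : 0 <= e <= 1 -> unit_fun g -> unit_fun (lazy P e g).
Proof.
move=> /andP[e0 e1] g1 x; have /andP[gx0 gx1] := g1 x.
have k0 : 0 <= kapp P g x.
  rewrite -[X in X <= _](_ : papp P [::] g x = 0) ?papp_le_kapp//.
  by rewrite /papp big_nil.
have : kapp P g x <= 1.
  apply: le_trans (ler_norm _) _.
  exact: (kapp_norm_le P_ge0 row_le1 x (unit_fun_bnd g1)).
by rewrite /lazy => k1; apply/andP; split; nra.
Qed.

Lemma iter_lazy_unit n e g : 0 <= e <= 1 -> unit_fun g ->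
  unit_fun (iter n (lazy P e) g).
Proof. by move=> e01 g1; elim: n => //= n IH; exact: lazy_unit. Qed.

Lemma iter_plazy_le n e F g x : uniq F -> 0 <= e <= 1 -> unit_fun g ->
  iter n (plazy P e F) g x <= iter n (lazy P e) g x.
Proof.
move=> uF e01 g1; elim: n x => //= n IH x; have /andP[e0 e1] := e01.
apply: lerD; first by rewrite ler_wpM2l// subr_ge0.
by rewrite ler_wpM2l// papp_le_kapp//; exact: iter_lazy_unit.
Qed.

(** The set and the function vary together. Domination by h gives the upper bound; for the lower
    one, positivity allows restricting to a fixed list that already carries almost all of the
    limit. *)
Lemma cvg_papp (g : nat -> V -> R) h x : unit_fun h ->
  (forall n y, 0 <= g n y <= h y) ->
  (forall y, g n y @[n --> \oo] --> h y) ->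
  papp P (enumV V n) (g n) x @[n --> \oo] --> kapp P h x.
Proof.
move=> h1 gh cg; apply/cvgrPdist_le => e e0.
have sP := abs_summable_row P_ge0 row_le1 x (unit_fun_bnd h1).
have e2 : 0 < e / 2 by rewrite divr_gt0.
have [m mP] : exists m, `|kapp P h x - papp P (enumV V m) h x| <= e / 2.
  have /cvgrPdist_le/(_ _ e2)[m _ Hm] := cvg_enum sP.
  by exists m; exact: Hm (leqnn m).
have cm : papp P (enumV V m) (g n) x @[n --> \oo] --> papp P (enumV V m) h x.
  by apply: cvg_sum_seq => y; apply: cvgMl_tmp.
near=> n.
have h2 : `|papp P (enumV V m) h x - papp P (enumV V m) (g n) x| <= e / 2.
  by near: n; move/cvgrPdist_le: cm; apply.
have h3 : papp P (enumV V m) (g n) x <= papp P (enumV V n) (g n) x.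
  apply: ler_sum_sub; rewrite ?enumV_uniq//.
    by near: n; exact: sub_enumV.
  by move=> y; rewrite mulr_ge0//; case/andP: (gh n y).
have h4 : papp P (enumV V n) (g n) x <= kapp P h x.
  by apply: papp_le_kapp; rewrite ?enumV_uniq// => y; case/andP: (gh n y).
move: mP h2; rewrite !ler_norml => /andP[_ m2] /andP[_ h22].
apply/andP; split; lra.
Unshelve. all: by end_near. Qed.

Lemma cvg_iter_plazy k e g x : 0 <= e <= 1 -> unit_fun g ->
  iter k (plazy P e (enumV V n)) g x @[n --> \oo] --> iter k (lazy P e) g x.
Proof.
move=> e01 g1; elim: k x => [|k IH] x; first exact: cvg_cst.
apply: cvgD; first by apply: cvgMl_tmp; exact: IH.
apply: cvgMl_tmp; apply: cvg_papp => [|n y|y]; last exact: IH.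
  exact: iter_lazy_unit.
rewrite iter_plazy_ge0//= ?iter_plazy_le ?enumV_uniq// => z.
by case/andP: (g1 z).
Qed.

Lemma delta_unit (y : V) : unit_fun (fun x : V => (x == y)%:R).
Proof. by move=> x; case: (_ == _); rewrite ?lexx ler01. Qed.

Lemma near_step t (c : R) : 0 <= t -> 0 < c ->
  \forall n \near \oo, (0 < n)%N /\ 0 <= t / n%:R <= c.
Proof.
move=> t0 c0; near=> n.
have n0 : (0 < n)%N by near: n; exact: nbhs_infty_gt.
split=> //; rewrite divr_ge0//= ler_pdivrMr ?ltr0n// mulrC -ler_pdivrMr//.
by near: n; exact: nbhs_infty_ger.
Unshelve. all: by end_near. Qed.

Lemma heat_unit t x y : 0 <= t -> 0 <= heat P t x y <= 1.
Proof.
move=> t0; have c := @cvg_iter_lazy_heat _ _ _ P_ge0 row_le1 t x y t0.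
apply/andP; split.
  apply: (@cvgr_to_ge _ _ _ _ _ _ _ c); near=> n.
  have [_ e01] : (0 < n)%N /\ 0 <= t / n%:R <= 1.
    by near: n; apply: near_step.
  by have /andP[] := iter_lazy_unit n e01 (delta_unit y) x.
apply: (@cvgr_to_le _ _ _ _ _ _ _ c); near=> n.
have [_ e01] : (0 < n)%N /\ 0 <= t / n%:R <= 1.
  by near: n; apply: near_step.
by have /andP[] := iter_lazy_unit n e01 (delta_unit y) x.
Unshelve. all: by end_near. Qed.

Variable pi : V -> R.
Hypothesis pi_gt0 : forall x, 0 < pi x.
Hypothesis piP_sym : forall x y, pi x * P x y = pi y * P y x.

Lemma ip_delta F g y : uniq F -> y \in F ->
  ip pi F g (fun x => (x == y)%:R) = pi y * g y.
Proof.
move=> uF yF; rewrite /ip (bigD1_seq y)//= eqxx mulr1 big1 ?addr0// => x.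
by move=> /negPf ->; rewrite mulr0.
Qed.

Lemma ip_iter_delta n e F g y : uniq F -> y \in F ->
  \sum_(x <- F) pi x * g x * iter n (plazy P e F) (fun x => (x == y)%:R) x =
  pi y * iter n (plazy P e F) g y.
Proof.
by move=> uF yF; rewrite -[LHS]/(ip pi F g _) -ip_iter_plazy_sym// ip_delta.
Qed.

(** The moment bound on F depends on n and e only through n e = t, and the walk killed outside F
    lies entrywise below the full one, so F stays fixed while n tends to infinity. *)
Lemma heat_form_lower t F h : uniq F -> 0 <= t -> (forall x, 0 <= h x) ->
  ip pi F h h - t * En P pi F h <=
  \sum_(y <- F) \sum_(x <- F) pi x * h x * heat P t x y * h y.
Proof.
move=> uF t0 h0.
have c : \sum_(y <- F) \sum_(x <- F) pi x * h x *
    iter n (lazy P (t / n%:R)) (fun z => (z == y)%:R) x * h y @[n --> \oo] -->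
  \sum_(y <- F) \sum_(x <- F) pi x * h x * heat P t x y * h y.
  apply: cvg_sum_seq => y; apply: cvg_sum_seq => x; apply: cvgMr_tmp.
  by apply: cvgMl_tmp; exact: cvg_iter_lazy_heat.
apply: (@cvgr_to_ge _ _ _ _ _ _ _ c); near=> n.
have [n0 /andP[e0 e2]] : (0 < n)%N /\ 0 <= t / n%:R <= 2^-1.
  by near: n; apply: near_step => //; rewrite invr_gt0.
set e := t / n%:R in e0 e2 *.
have e01 : 0 <= e <= 1 by rewrite e0 (le_trans e2)//; lra.
have ne : n%:R * e = t by rewrite mulrC divfK// pnatr_eq0 -lt0n.
rewrite -ne -mulrA.
apply: le_trans (moment_lower P_ge0 pi_gt0 piP_sym row_le1 e0 e2 uF n h) _.
rewrite /ip big_seq [leRHS]big_seq; apply: ler_sum => y yF.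
rewrite -ip_iter_delta// mulr_suml; apply: ler_sum => x _.
rewrite ler_wpM2r//; apply: ler_wpM2l; first by rewrite mulr_ge0// ltW.
by apply: iter_plazy_le => //; exact: delta_unit.
Unshelve. all: by end_near. Qed.

(* A strict lower bound on the energy of the heat flow is already seen by a
   discrete lazy walk killed outside a finite set. *)
Lemma heat_act_approx t (mu : V -> R) G (a : R) :
  0 <= t -> (forall x, 0 <= mu x) -> abs_summable mu -> uniq G ->
  a < \sum_(y <- G) pi y * (kact mu (heat P t) y / pi y) ^+ 2 ->
  exists F n e, [/\ uniq F, 0 <= e <= 2^-1, n%:R * e = t &
    let g := iter n (plazy P e F) (fun x => mu x / pi x) in a < ip pi F g g].
Proof.
move=> t0 mu0 smu uG aG.
have sH y : abs_summable (fun x => mu x * heat P t x y).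
  apply: abs_summable_le smu => x; have /andP[h0 h1] := heat_unit x y t0.
  by rewrite normrM [`|heat _ _ _ _|]ger0_norm// ler_piMr.
have sqc (u : nat -> V -> R) (l : V -> R) :
    (forall y, u n y @[n --> \oo] --> l y) ->
    \sum_(y <- G) pi y * (u n y / pi y) ^+ 2 @[n --> \oo] -->
    \sum_(y <- G) pi y * (l y / pi y) ^+ 2.
  move=> ul; apply: cvg_sum_seq => y; apply: cvgMl_tmp.
  by rewrite !expr2; apply: cvgM; apply: cvgMr_tmp.
(* Three limits follow, the strict inequality surviving each: [mu] is cut to a finite list, the heat
   kernel replaced by a lazy power, and the lazy walk killed outside a finite set. *)
have [m] : exists m, a < \sum_(y <- G) pi y *
    ((\sum_(x <- enumV V m) mu x * heat P t x y) / pi y) ^+ 2.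
  have := cvgr_gt _ (sqc _ _ (fun y => cvg_enum (sH y))) _ aG.
  by case=> m _ /(_ m (leqnn m)); exists m.
move=> {}aG.
have : \forall n \near \oo, a < \sum_(y <- G) pi y *
    ((\sum_(x <- enumV V m) mu x * iter n (lazy P (t / n%:R))
       (fun z => (z == y)%:R) x) / pi y) ^+ 2.
  apply: (cvgr_gt _ (sqc (fun n y => \sum_(x <- enumV V m) mu x *
    iter n (lazy P (t / n%:R)) (fun z => (z == y)%:R) x) _ _) _ aG) => y.
  by apply: cvg_sum_seq => x; apply: cvgMl_tmp; exact: cvg_iter_lazy_heat.
move=> {}aG.
have [n [n0 e02 {}aG]] : exists n, [/\ (0 < n)%N, 0 <= t / n%:R <= 2^-1 &
   a < \sum_(y <- G) pi y *
    ((\sum_(x <- enumV V m) mu x * iter n (lazy P (t / n%:R))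
       (fun z => (z == y)%:R) x) / pi y) ^+ 2].
  have h2 : 0 < 2^-1 :> R by rewrite invr_gt0.
  have [k _ Hk] := filterI aG (near_step t0 h2).
  by exists k; have [? []] := Hk k (leqnn k).
set e := t / n%:R in e02 aG.
have e01 : 0 <= e <= 1 by case/andP: e02 => -> /= /le_trans; apply; lra.
have ne : n%:R * e = t by rewrite mulrC divfK// pnatr_eq0 -lt0n.
have {}aG : \forall k \near \oo, a < \sum_(y <- G) pi y *
    ((\sum_(x <- enumV V m) mu x * iter n (plazy P e (enumV V k))
       (fun z => (z == y)%:R) x) / pi y) ^+ 2.
  apply: (cvgr_gt _ (sqc (fun k y => \sum_(x <- enumV V m) mu x *
    iter n (plazy P e (enumV V k)) (fun z => (z == y)%:R) x) _ _) _ aG) => y.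
  apply: cvg_sum_seq => x; apply: cvgMl_tmp; apply: cvg_iter_plazy => //.
  exact: delta_unit.
have [k [{}aG Gk mk]] : exists k, [/\ a < \sum_(y <- G) pi y *
    ((\sum_(x <- enumV V m) mu x * iter n (plazy P e (enumV V k))
       (fun z => (z == y)%:R) x) / pi y) ^+ 2,
   {subset G <= enumV V k} & {subset enumV V m <= enumV V k}].
  have [k _ Hk] := filterI aG (filterI (sub_enumV G) (sub_enumV (enumV V m))).
  by exists k; have [? []] := Hk k (leqnn k).
exists (enumV V k), n, e; split=> //; first exact: enumV_uniq.
apply: (lt_le_trans aG) => {aG}.
set F := enumV V k; set g := iter n _ (fun x => mu x / pi x).
have uF : uniq F by exact: enumV_uniq.
have g0 x : 0 <= g x by apply: iter_plazy_ge0 => // z; rewrite divr_ge0// ltW.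
(* All terms are nonnegative, so restoring the mass of [mu] on F that was cut off and enlarging G to
   F only raise the sum. *)
apply: (@le_trans _ _ (\sum_(y <- G) pi y * g y ^+ 2)); last first.
  have -> : ip pi F g g = \sum_(y <- F) pi y * g y ^+ 2.
    by apply: eq_bigr => y _; rewrite expr2 mulrA.
  apply: ler_sum_sub => // y; rewrite mulr_ge0 ?sqr_ge0//; exact: ltW.
rewrite big_seq [leRHS]big_seq; apply: ler_sum => y yG.
have d0 x : 0 <= iter n (plazy P e F) (fun z => (z == y)%:R) x.
  by apply: iter_plazy_ge0 => // z; exact: ler0n.
rewrite ler_pM2l// lerXn2r ?nnegrE//.
  by rewrite divr_ge0 ?(ltW (pi_gt0 y))// sumr_ge0// => x _; exact: mulr_ge0.
rewrite ler_pdivrMr// [leRHS]mulrC -ip_iter_delta//; last exact: Gk.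
apply: (@le_trans _ _ (\sum_(x <- F) mu x *
    iter n (plazy P e F) (fun z => (z == y)%:R) x)).
  by apply: ler_sum_sub => // [|x]; [exact: enumV_uniq|exact: mulr_ge0].
by apply: ler_sum => x _; rewrite mulrCA divff ?mulr1// gt_eqF.
Qed.

End FiniteApproximation.

(** * Operator norms and the spectral profile *)

Section Norms.
Variables (R : realType) (V : countType) (P : V -> V -> R) (pi : V -> R).
Hypothesis P_ge0 : forall x y, 0 <= P x y.
Hypothesis row_le1 : forall (F : seq V) x, uniq F -> \sum_(y <- F) P x y <= 1.
Hypothesis pi_gt0 : forall x, 0 < pi x.
Hypothesis piP_sym : forall x y, pi x * P x y = pi y * P y x.

Let wsq_ge0 x (a : R) : 0 <= pi x * a ^+ 2.
Proof. by apply: mulr_ge0; [exact: ltW|exact: sqr_ge0]. Qed.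

Lemma lnormE f : lnorm pi 2 f =
  ((\esum_(v in [set: V]) (pi v * f v ^+ 2)%:E) `^ 2^-1)%E.
Proof.
rewrite /lnorm; congr (_ `^ _)%E; apply: eq_esum => v _.
by rewrite powR_mulrn ?normr_ge0// real_normK ?num_real.
Qed.

Lemma lnorm_sqr f : (lnorm pi 2 f ^+ 2)%E =
  \esum_(v in [set: V]) (pi v * f v ^+ 2)%:E.
Proof.
rewrite lnormE; set S := esum _ _.
have : (0 <= S)%E by apply: esum_ge0 => v _; rewrite lee_fin.
case: S => [r| |]//.
  rewrite lee_fin => r0; rewrite poweR_EFin -EFin_expe powR12_sqrt//.
  by rewrite sqr_sqrtr.
by move=> _; rewrite poweRyr ?invr_eq0 ?pnatr_eq0.
Qed.

Lemma lnorm_support f s : uniq s -> (forall x, x \notin s -> f x = 0) ->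
  lnorm pi 2 f = (Num.sqrt (ip pi s f f))%:E.
Proof.
move=> us fs; rewrite lnormE (esum_support us) => [||x /fs ->]//.
- rewrite poweR_EFin powR12_sqrt; last exact: sumr_ge0.
  by congr (Num.sqrt _)%:E; apply: eq_bigr => x _; rewrite expr2 mulrA.
- by rewrite expr0n mulr0.
Qed.

Lemma lnorm_le f (r : R) : 0 <= r ->
  (\esum_(v in [set: V]) (pi v * f v ^+ 2)%:E <= (r ^+ 2)%:E)%E ->
  (lnorm pi 2 f <= r%:E)%E.
Proof.
move=> r0; rewrite lnormE; set S := esum _ _.
have : (0 <= S)%E by apply: esum_ge0 => v _; rewrite lee_fin.
case: S => [q| |]//; rewrite 2!lee_fin => q0 qr.
rewrite poweR_EFin lee_fin powR12_sqrt// -(ger0_norm r0) -sqrtr_sqr.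
by rewrite ler_sqrt// sqr_ge0.
Qed.

Lemma mass_seq s : uniq s -> mass pi [set` s] = (\sum_(x <- s) pi x)%:E.
Proof.
move=> us; rewrite /mass esum_fset ?finite_seq//; last first.
  by move=> x _; rewrite lee_fin ltW.
by rewrite -sumEFin (fsbig_seq _ (fun x => (pi x)%:E) us).
Qed.

Lemma mem_seq_set (s : seq V) x : (x \in [set` s]) = (x \in s).
Proof. by apply/idP/idP; rewrite inE. Qed.

Lemma kapp_krestr_seq s f x : uniq s ->
  kapp (krestr P [set` s]) f x = (x \in s)%:R * papp P s f x.
Proof.
move=> us; rewrite /kapp (vsum_support us) => [|y ys]; last first.
  by rewrite /krestr !mem_seq_set (negPf ys) andbF mulr0 mul0r.
rewrite /papp mulr_sumr big_seq [RHS]big_seq; apply: eq_bigr => y ys.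
by rewrite /krestr !mem_seq_set ys andbT; ring.
Qed.

(** For the unit vector f = k / |k| cut to s the energy is 1 - <P f, f>, and Cauchy-Schwarz bounds
    <P f, f> by the norm of P f on s, hence by the operator norm. *)
Lemma Lambda_energy_seq (lam u : R) s k : uniq s ->
  (lam%:E <= Lambda P pi u)%E -> \sum_(x <- s) pi x <= u ->
  lam * ip pi s k k <= En P pi s k.
Proof.
move=> us lamL su.
have := ip_ge0 pi_gt0 s k; rewrite le_eqVlt => /orP[/eqP <-|kk].
  by rewrite mulr0; exact: En_ge0.
have s0 : 0 < \sum_(x <- s) pi x.
  rewrite lt_neqAle sumr_ge0 ?andbT; last by move=> x _; exact: ltW.
  case: s us su kk => [|x s] us su kk; first by rewrite /ip big_nil ltxx in kk.
  rewrite eq_sym gt_eqF// big_cons ltr_wpDr// sumr_ge0// => y _; exact: ltW.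
pose N := Num.sqrt (ip pi s k k); have N0 : 0 < N by rewrite sqrtr_gt0.
pose f x := (x \in s)%:R * k x / N.
have fs x : x \notin s -> f x = 0 by move=> /negPf xs; rewrite /f xs !mul0r.
have kf : {in s, k =1 fun x => N * f x}.
  by move=> x xs; rewrite /f xs mul1r mulrC divfK// gt_eqF.
have NN : N ^+ 2 = ip pi s k k by rewrite sqr_sqrtr// ltW.
have ff : ip pi s f f = 1.
  have N2 : N ^+ 2 != 0 by rewrite expf_neq0 ?gt_eqF.
  by apply: (mulfI N2); rewrite -ipZ -(eq_ip pi kf kf) -NN mulr1.
rewrite (eq_En P pi kf) EnZ -NN mulrC ler_pM2l ?exprn_gt0// /En ff.
set r := Num.sqrt (ip pi s (papp P s f) (papp P s f)).
have le_r : ip pi s (papp P s f) f <= r.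
  rewrite (le_trans (ler_norm _))// -sqrtr_sqr ler_sqrt ?ip_ge0//.
  by rewrite (le_trans (ip_cauchy_schwarz pi_gt0 _ _ _))// ff mulr1.
suff : lam <= 1 - r by move/le_trans; apply; rewrite lerB.
rewrite -lee_fin (le_trans lamL)//.
have : (1 - opnorm pi (krestr P [set` s]) <= 1 - r%:E)%E.
  apply: leeB => //; apply: ereal_sup_ubound; exists f.
    by rewrite /= (lnorm_support us fs) ff sqrtr1; split => //; exact: ltry.
  rewrite (@lnorm_support _ s)//; last first.
    by move=> x /negPf xs; rewrite kapp_krestr_seq// xs mul0r.
  congr (Num.sqrt _)%:E; apply: eq_ip => x xs;
    by rewrite kapp_krestr_seq// xs mul1r.
rewrite -EFinB; apply: le_trans; apply: ereal_inf_lbound.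
by exists [set` s] => //; rewrite /= mass_seq// lte_fin lee_fin.
Qed.

Lemma Lambda_energy (lam u : R) F k (p : pred V) : uniq F ->
  (lam%:E <= Lambda P pi u)%E -> \sum_(x <- F | p x) pi x <= u ->
  (forall x, ~~ p x -> k x = 0) -> lam * ip pi F k k <= En P pi F k.
Proof.
move=> uF lamL Fu kp.
have kE : (fun x => (p x)%:R * k x) =1 k.
  move=> x; case: (boolP (p x)) => [|/kp ->]; by rewrite ?mul1r ?mulr0.
have := @Lambda_energy_seq lam u [seq x <- F | p x] k (filter_uniq _ uF) lamL.
rewrite big_filter => /(_ Fu).
rewrite En_filter (eq_En _ _ (fun x _ => kE x)) ip_filter.
by rewrite (eq_ip _ (fun x _ => erefl) (fun x _ => kE x)).
Qed.

(** Since B may be infinite, [papp_sq_le] is applied on the finite sets of points of B in [enumV]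
    and the bound is passed to the limit. *)
Lemma opnorm_krestr_le (m : R) (B : set V) : 0 <= m ->
  (forall s g, uniq s -> (forall x, x \in s -> B x) -> (forall x, 0 <= g x) ->
     ip pi s (papp P s g) g <= m * ip pi s g g) ->
  (opnorm pi (krestr P B) <= m%:E)%E.
Proof.
move=> m0 Hm; apply: ge_ereal_sup => _ [f [_ f1] <-].
have esf : \esum_(v in [set: V]) (pi v * f v ^+ 2)%:E = 1%E.
  by rewrite -lnorm_sqr f1 expe2 mule1.
have sf s : uniq s -> ip pi s f f <= 1.
  move=> us; rewrite -lee_fin -esf; apply: le_trans (sum_le_esum us _) => //.
  by rewrite lee_fin; apply: ler_sum => x _; rewrite expr2 mulrA.
apply: lnorm_le => //; apply: esum_le => s us; rewrite lee_fin.
(* Summability although f may be unbounded: |f| <= 1 + f^2, and reversibility with P y x <= 1 gives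
   P x y f(y)^2 <= pi(y) f(y)^2 / pi(x). *)
have sK x : abs_summable (fun y => krestr P B x y * f y).
  exists (1 + (pi x)^-1) => r ur.
  apply: (@le_trans _ _ (\sum_(y <- r) (P x y + (pi x)^-1 * (pi y * f y * f y)))).
    apply: ler_sum => y _; rewrite /krestr !normrM.
    have Pyx : P y x <= 1 by have := @row_le1 [:: x] y isT; rewrite big_seq1.
    have PE : P x y = (pi x)^-1 * (pi y * P y x).
      by rewrite -piP_sym mulKf ?gt_eqF.
    have h1 : P x y * f y ^+ 2 <= (pi x)^-1 * (pi y * f y * f y).
      rewrite PE -[leLHS]mulrA; apply: ler_wpM2l.
        by rewrite invr_ge0 ltW.
      by rewrite -[leRHS]mulrA -expr2 mulrAC -[leRHS]mulr1 ler_wpM2l.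
    have h2 : `|f y| <= 1 + f y ^+ 2.
      by rewrite -[f y ^+ 2]real_normK ?num_real//; nra.
    have h3 := ler_wpM2l (P_ge0 x y) h2.
    apply: (@le_trans _ _ (P x y * `|f y|)); last by lra.
    rewrite ger0_norm// ler_wpM2r// normr_nat.
    by case: (_ && _); rewrite ?mulr1 ?mulr0.
  rewrite big_split /= -mulr_sumr lerD ?row_le1// -[leRHS]mulr1.
  by rewrite ler_wpM2l ?invr_ge0 ?(ltW (pi_gt0 x))// sf.
have c : \sum_(x <- s) pi x * (\sum_(y <- enumV V n) krestr P B x y * f y) ^+ 2
    @[n --> \oo] --> \sum_(x <- s) pi x * kapp (krestr P B) f x ^+ 2.
  apply: cvg_sum_seq => x; apply: cvgMl_tmp; rewrite expr2.
  under eq_cvg do rewrite expr2.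
  by apply: cvgM; exact: cvg_enum.
apply: (@cvgr_to_le _ _ _ _ _ _ _ c); near=> n.
have sn : {subset s <= enumV V n} by near: n; exact: sub_enumV.
have un := enumV_uniq V n.
pose D := [seq x <- enumV V n | x \in B].
have uD : uniq D by exact: filter_uniq.
apply: le_trans (_ : ip pi D (papp P D f) (papp P D f) <= _); last first.
  apply: (@le_trans _ _ (m ^+ 2 * ip pi D f f)).
    apply: papp_sq_le => // g g0; apply: Hm => // x.
    by rewrite mem_filter => /andP[/set_mem].
  by rewrite -[leRHS]mulr1 ler_wpM2l ?sqr_ge0 ?sf.
apply: (@le_trans _ _ (\sum_(x <- enumV V n) pi x *
   (\sum_(y <- enumV V n) krestr P B x y * f y) ^+ 2)).
  exact: ler_sum_sub.
rewrite /ip big_filter [leRHS]big_mkcond; apply: ler_sum => x _.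
have kE y : krestr P B x y * f y =
    (x \in B)%:R * (if y \in B then P x y * f y else 0).
  by rewrite /krestr; case: (x \in B); case: (y \in B) => /=; ring.
under eq_bigr do rewrite kE.
rewrite -mulr_sumr /papp big_filter -big_mkcond /=.
by case: (x \in B); rewrite ?mul1r ?mul0r ?expr0n ?mulr0//= expr2 mulrA.
Unshelve. all: by end_near. Qed.

Lemma Lambda_ge0 u : (0 <= Lambda P pi u)%E.
Proof.
apply: le_ereal_inf_tmp => _ [B _ <-].
have H : (opnorm pi (krestr P B) <= 1%:E)%E.
  apply: opnorm_krestr_le => // s g us _ _.
  by rewrite mul1r -subr_ge0; exact: En_ge0.
by apply: le_trans (leeB (lexx 1%E) H); rewrite -EFinB subrr.
Qed.

End Norms.

(** * Lower bound *)

Section LowerBound.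
Variables (R : realType) (V : countType) (P : V -> V -> R) (pi : V -> R).
Hypothesis P_ge0 : forall x y, 0 <= P x y.
Hypothesis row_le1 : forall (F : seq V) x, uniq F -> \sum_(y <- F) P x y <= 1.
Hypothesis pi_gt0 : forall x, 0 < pi x.
Hypothesis piP_sym : forall x y, pi x * P x y = pi y * P y x.

Lemma kpow_krestrS D n x y : uniq D ->
  kpow (krestr P [set` D]) n.+1 x y =
  (x \in D)%:R * \sum_(z <- D) P x z * kpow (krestr P [set` D]) n z y.
Proof.
by move=> uD; rewrite -[LHS]/(kapp (krestr P [set` D])
  (fun z => kpow (krestr P [set` D]) n z y) x) kapp_krestr_seq.
Qed.

Lemma kpow_krestr_ge0 D n x y : uniq D -> 0 <= kpow (krestr P [set` D]) n x y.
Proof.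
move=> uD; elim: n x => [|n IH] x; first exact: ler0n.
by rewrite kpow_krestrS// mulr_ge0 ?ler0n// sumr_ge0// => z _; exact: mulr_ge0.
Qed.

Lemma irreducible_onP D : uniq D -> D != [::] ->
  {in D &, forall x y, exists n, 0 < kpow (krestr P [set` D]) n x y} ->
  irreducible_on P [set` D].
Proof.
move=> uD D0 H; split.
  by case: D {uD H} D0 => // x D _; exists x; rewrite /= mem_head.
move=> x y xD yD; have [n n0] := H x y xD yD.
apply: (@lt_le_trans _ _
  (\sum_(0 <= i < n.+1) (kpow (krestr P [set` D]) i x y)%:E)%E).
  rewrite sumEFin lte_fin big_nat_recr//=; apply: ltr_wpDl => //.
  by apply: sumr_ge0 => i _; exact: kpow_krestr_ge0.
apply: nneseries_lim_ge => i _ _; rewrite lee_fin; exact: kpow_krestr_ge0.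
Qed.

(* Energy and mass are additive over the connected components of D, so one
   of the components inherits the inequality. *)
Lemma irreducible_component (t : R) (phi h : V -> R) D :
  uniq D -> 0 <= t -> t * En P pi D h < \sum_(x <- D) phi x ->
  exists C, [/\ uniq C, {subset C <= D}, C != [::],
    irreducible_on P [set` C] & t * En P pi C h < \sum_(x <- C) phi x].
Proof.
move=> + t0; have [n] := ubnP (size D); elim: n D => // n IH D sD uD lt.
have D0 : D != [::].
  apply/eqP => D0; move: lt; rewrite D0 /En /ip !big_nil subr0 mulr0.
  by rewrite ltxx.
have [H|] := pselect ({in D &, forall x y,
    exists n, 0 < kpow (krestr P [set` D]) n x y}).
  by exists D; split=> //; exact: irreducible_onP.
move=> /existsNP[x /existsNP[y /not_implyP[xD /not_implyP[yD nxy]]]].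
(* The points of D leading to y inside D: no edge enters them from the rest of D. As y is one and x
   is not, both parts are smaller than D. *)
pose p z := `[< exists n, 0 < kpow (krestr P [set` D]) n z y >].
have px : ~~ p x by apply/asboolPn.
have py : p y.
  by apply/asboolP; exists 0%N; rewrite /kpow /= /kid eqxx.
have Pnp : {in D &, forall w z, ~~ p w -> ~~ ~~ p z -> P w z = 0}.
  move=> w z wD zD /asboolPn pw; rewrite negbK => /asboolP[k pz].
  apply/eqP; rewrite eq_le P_ge0 andbT leNgt; apply/negP => wz.
  apply: pw; exists k.+1; rewrite kpow_krestrS// wD mul1r.
  rewrite (bigD1_seq z)//= ltr_wpDr ?mulr_gt0// sumr_ge0// => u _.
  by rewrite mulr_ge0// kpow_krestr_ge0.
have En_D := En_split pi_gt0 piP_sym h Pnp.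
have sum_D : \sum_(x <- D) phi x = \sum_(x <- [seq x <- D | ~~ p x]) phi x
    + \sum_(x <- [seq x <- D | ~~ ~~ p x]) phi x.
  by rewrite !big_filter; exact: bigID.
have sz q z : z \in D -> ~~ q z -> (size [seq x <- D | q x] < n)%N.
  move=> zD qz; rewrite -ltnS (leq_trans _ sD)// ltnS size_filter.
  by rewrite -(count_predC q D) -ltn_subLR// subnn -has_count; apply/hasP; exists z.
have [h1|h1] := ltP (t * En P pi [seq x <- D | ~~ p x] h)
  (\sum_(x <- [seq x <- D | ~~ p x]) phi x).
  have [C [uC CD C0 iC ltC]] := IH _ (sz (fun z => ~~ p z) y yD
    (introT negPn py)) (filter_uniq _ uD) h1.
  exists C; split=> // z /CD; by rewrite mem_filter => /andP[].
have h2 : t * En P pi [seq x <- D | ~~ ~~ p x] h <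
  \sum_(x <- [seq x <- D | ~~ ~~ p x]) phi x.
  by move: lt; rewrite En_D sum_D mulrDr; lra.
have [|C [uC CD C0 iC ltC]] := IH _ _ (filter_uniq _ uD) h2.
  by apply: (sz (fun z => ~~ ~~ p z) x xD); rewrite negbK.
exists C; split=> // z /CD; by rewrite mem_filter => /andP[].
Qed.

Lemma cond_dist_seqE s x : uniq s ->
  cond_dist pi [set` s] x = (x \in s)%:R * pi x / \sum_(y <- s) pi y.
Proof. by move=> us; rewrite /cond_dist mass_seq//= mem_seq_set [pi x * _]mulrC. Qed.

Lemma sum_pi_gt0 (s : seq V) : s != [::] -> 0 < \sum_(x <- s) pi x.
Proof.
case: s => // x s _; rewrite big_cons; apply: ltr_wpDr => //.
by apply: sumr_ge0 => y _; exact: ltW.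
Qed.

Lemma mnorm_cond_dist s : uniq s -> s != [::] ->
  (mnorm pi 2 (cond_dist pi [set` s]) ^+ 2)%E = ((\sum_(x <- s) pi x)^-1)%:E.
Proof.
move=> us s0; have m0 := sum_pi_gt0 s0.
rewrite /mnorm lnorm_sqr// (esum_support us).
- congr _%:E; transitivity (\sum_(x <- s) pi x * (\sum_(x <- s) pi x) ^- 2).
    rewrite big_seq [RHS]big_seq; apply: eq_bigr => x xs.
    rewrite cond_dist_seqE// xs mul1r mulrAC divff ?gt_eqF// mul1r.
    by rewrite exprVn.
  by rewrite -mulr_suml expr2 invfM mulrA divff ?mul1r// gt_eqF.
- by move=> x; rewrite mulr_ge0 ?sqr_ge0// ltW.
- move=> x /negPf xs.
  by rewrite cond_dist_seqE// xs !mul0r expr0n mulr0.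
Qed.

(** Let w be the density of pi_C P_t and m = pi(C). Decay gives |w|^2 <= 2^-8 / m, and |h|^2 <= m,
    so <w, h> <= 1/16. As h <= 1, m <w, h> dominates the heat form of h, which [heat_form_lower]
    bounds below. *)
Lemma cond_decay_energy t C h : uniq C -> C != [::] -> 0 <= t ->
  (forall x, 0 <= h x <= 1) ->
  (mnorm pi 2 (kact (cond_dist pi [set` C]) (heat P t)) ^+ 2
     <= (2 ^- 8)%:E * mnorm pi 2 (cond_dist pi [set` C]) ^+ 2)%E ->
  ip pi C h h - t * En P pi C h <= 16^-1 * \sum_(x <- C) pi x.
Proof.
move=> uC C0 t0 h1; rewrite (mnorm_cond_dist uC C0).
set m := \sum_(x <- C) pi x.
have m0 : 0 < m by exact: sum_pi_gt0.
have h0 x : 0 <= h x by case/andP: (h1 x).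
pose w y := kact (cond_dist pi [set` C]) (heat P t) y / pi y.
have wE y : pi y * w y = (\sum_(x <- C) pi x * heat P t x y) / m.
  rewrite /w mulrC divfK ?gt_eqF// /kact (vsum_support uC) => [|x xC].
    rewrite mulr_suml big_seq [RHS]big_seq; apply: eq_bigr => x xC.
    by rewrite cond_dist_seqE// xC mul1r mulrAC.
  by rewrite cond_dist_seqE// (negPf xC) !mul0r.
rewrite /mnorm lnorm_sqr// => /(le_trans (sum_le_esum uC _)).
rewrite -EFinM lee_fin => H.
have {}H : ip pi C w w <= 2 ^- 8 * m^-1.
  rewrite (le_trans _ (H _))//; last first.
    by move=> x; rewrite mulr_ge0 ?sqr_ge0// ltW.
  by apply: ler_sum => x _; rewrite /w expr2 mulrA.
have hh : ip pi C h h <= m.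
  apply: ler_sum => x _; case/andP: (h1 x) => hx0 hx1.
  rewrite -mulrA -[leRHS]mulr1 ler_pM2l//; nra.
have whle : ip pi C w h <= 16^-1.
  have cs := ip_cauchy_schwarz pi_gt0 C w h.
  have : ip pi C w h ^+ 2 <= 16^-1 ^+ 2.
    apply: (le_trans cs); apply: (@le_trans _ _ (2 ^- 8 * m^-1 * m)).
      by apply: ler_pM => //; exact: ip_ge0.
    by rewrite mulfVK ?gt_eqF//; lra.
  nra.
apply: le_trans (heat_form_lower P_ge0 row_le1 pi_gt0 piP_sym uC t0 h0) _.
apply: (@le_trans _ _ (m * ip pi C w h)); last by rewrite mulrC ler_pM2r.
rewrite /ip mulr_sumr; apply: ler_sum => y _.
rewrite wE mulrAC mulrC divfK ?gt_eqF// mulr_suml; apply: ler_sum => x _.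
rewrite ler_wpM2r// -mulrA ler_pM2l//.
have /andP[k0 _] := heat_unit P_ge0 row_le1 x y t0.
by case/andP: (h1 x) => hx0 hx1; rewrite ler_piMl.
Qed.

(** If some slice violated the hypothesis of [dyadic_energy], the slice divided by s, on a suitable
    component C, would be a function h that equals 1 where f > 2s and contradicts the decay from
    pi_C. *)
Lemma chi_energy t u D f : 0 <= t ->
  (forall B, FI P pi u B ->
      (mnorm pi 2 (kact (cond_dist pi B) (heat P t)) ^+ 2
         <= (2 ^- 8)%:E * mnorm pi 2 (cond_dist pi B) ^+ 2)%E) ->
  uniq D -> \sum_(x <- D) pi x <= u -> (forall x, 0 <= f x) ->
  ip pi D f f <= 2 ^+ 9 * (t * En P pi D f).
Proof.
move=> t0 Hchi uD Du f0; apply: dyadic_energy => // s s0.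
rewrite leNgt; apply/negP => bad.
pose D' := [seq x <- D | s < f x].
pose h x := slice s (f x) / s.
have h1 x : 0 <= h x <= 1.
  by rewrite divr_ge0 ?slice_ge0 ?(ltW s0)//= ler_pdivrMr// mul1r slice_le.
pose b x : R := (2 * s < f x)%R%:R.
have EnE' : En P pi D (fun x => slice s (f x)) = s ^+ 2 * En P pi D' h.
  rewrite -EnZ En_filter; apply: eq_En => x _.
  rewrite /h [s * _]mulrC divfK ?gt_eqF//.
  have [//|fs] := ltP s (f x); first by rewrite mul1r.
  by rewrite mul0r slice_eq0.
pose phi x := 16^-1 * (pi x * (b x - 1 / 8)).
have lt : t * En P pi D' h < \sum_(x <- D') phi x.
  rewrite -(ltr_pM2l (exprn_gt0 2 s0)) mulrCA -EnE' (lt_le_trans bad)//.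
  rewrite mulrCA ler_pM2l ?exprn_gt0// mulr_sumr big_filter [leRHS]big_mkcond.
  apply: ler_sum => x _; rewrite /phi -/(b x); case: ifPn => [//|sx] /=.
  rewrite /b (_ : (_ < _) = false) ?mul0r ?subr0 ?mulr0//.
  by apply/negP => fx; move: sx; rewrite -leNgt => sx; lra.
have uD' : uniq D' by exact: filter_uniq.
have [C [uC CD C0 iC ltC]] := irreducible_component uD' t0 lt.
pose m := \sum_(x <- C) pi x.
have Cu : m <= u.
  apply: le_trans Du; apply: ler_sum_sub => // [x /CD|x]; last exact: ltW.
  by rewrite mem_filter => /andP[].
have FIC : FI P pi u [set` C].
  split=> //; [by case: iC|exact: finite_seq|by rewrite mass_seq// lee_fin].
have := cond_decay_energy uC C0 t0 h1 (Hchi _ FIC); rewrite -/m.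
pose X := \sum_(x <- C) pi x * b x.
have sphi : \sum_(x <- C) phi x = 16^-1 * (X - 1 / 8 * m).
  rewrite /phi -mulr_sumr; congr (_ * _); rewrite /X /m mulr_sumr -sumrB.
  by apply: eq_bigr => x _; ring.
have hX : X <= ip pi C h h.
  apply: ler_sum => x _; rewrite -mulrA ler_pM2l// /b.
  have [hx|_] := ltP (2 * s) (f x); last by rewrite /= -expr2 sqr_ge0.
  by rewrite /h slice_eq// divff ?mulr1// gt_eqF.
have E0 : 0 <= t * En P pi C h by rewrite mulr_ge0// En_ge0.
have m0 : 0 <= m by apply: sumr_ge0 => x _; exact: ltW.
(* Write E = t E(h). From 0 <= E < (X - m/8) / 16 follows X > m/8; with X - E <= m/16 it also
   follows that X < 7 m / 120. *)
move: ltC; rewrite sphi; lra.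
Qed.

Lemma mass_gt0_ex (B : set V) : (0 < mass pi B)%E -> exists x, B x.
Proof.
move=> B0; apply: contrapT => nB; move: B0; rewrite /mass esum1 ?ltxx// => i Bi.
by case: nB; exists i.
Qed.

Lemma sum_seq_le_mass (B : set V) s (u : R) : uniq s ->
  (forall x, x \in s -> B x) -> (mass pi B <= u%:E)%E ->
  \sum_(x <- s) pi x <= u.
Proof.
move=> us sB Bu; rewrite -lee_fin; apply: le_trans Bu; apply: esum_ge.
exists [set` s]; first by split; [exact: finite_seq|].
by rewrite -(fsbig_seq _ (fun x => (pi x)%:E) us) sumEFin.
Qed.

Lemma Lambda_lower t u : 0 < t ->
  (forall B, FI P pi u B ->
      (mnorm pi 2 (kact (cond_dist pi B) (heat P t)) ^+ 2
         <= (2 ^- 8)%:E * mnorm pi 2 (cond_dist pi B) ^+ 2)%E) ->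
  ((2 ^- 9 / t)%:E <= Lambda P pi u)%E.
Proof.
move=> t0 Hchi; apply: le_ereal_inf_tmp => _ [B [B0 Bu] <-].
pose m := 1 - 2 ^- 9 / t.
have Hm s g : uniq s -> (forall x, x \in s -> B x) -> (forall x, 0 <= g x) ->
    ip pi s (papp P s g) g <= m * ip pi s g g.
  move=> us sB g0.
  have := chi_energy (ltW t0) Hchi us (sum_seq_le_mass us sB Bu) g0.
  rewrite mulrA -ler_pdivrMl ?mulr_gt0 ?exprn_gt0 ?ltr0n// invfM.
  rewrite /En mulrBl mul1r lerBrDr addrC -lerBrDr; apply.
(* The norm bound requires m >= 0; the form at a single point of B gives pi x * P x x <= m * pi
   x. *)
have m0 : 0 <= m.
  have [x Bx] := mass_gt0_ex B0.
  have := Hm [:: x] (fun _ => 1) isT _ (fun _ => ler01).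
  rewrite /ip /papp !big_seq1 !mulr1 => H.
  rewrite -(pmulr_lge0 m (pi_gt0 x)); apply: le_trans (H _).
    by apply: mulr_ge0 => //; exact: ltW.
  by move=> y; rewrite inE => /eqP->.
have := opnorm_krestr_le P_ge0 row_le1 pi_gt0 piP_sym m0 Hm.
move=> /(leeB (lexx 1%E)); apply: le_trans.
by rewrite -EFinB lee_fin /m opprB addrC subrK.
Qed.

(** At t = 0 the energy bound on a point of mass at most u would read pi x <= 0. Hence no set has
    mass in (0, u], and Lambda is the infimum of the empty set. *)
Lemma Lambda_lower0 u :
  (forall B, FI P pi u B ->
      (mnorm pi 2 (kact (cond_dist pi B) (heat P 0)) ^+ 2
         <= (2 ^- 8)%:E * mnorm pi 2 (cond_dist pi B) ^+ 2)%E) ->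
  Lambda P pi u = +oo%E.
Proof.
move=> Hchi; apply/eqP; rewrite -leye_eq.
apply: le_ereal_inf_tmp => _ [B [B0 Bu] <-]; exfalso.
have [x Bx] := mass_gt0_ex B0.
have xB y : y \in [:: x] -> B y by rewrite inE => /eqP->.
have xu := sum_seq_le_mass (isT : uniq [:: x]) xB Bu.
have := chi_energy (lexx 0) Hchi (isT : uniq [:: x]) xu (fun _ => ler01).
by rewrite mul0r mulr0 /ip big_seq1 !mulr1 leNgt pi_gt0.
Qed.

End LowerBound.

(** * Upper bound *)

Section UpperBound.
Variables (R : realType) (V : countType) (P : V -> V -> R) (pi : V -> R).
Hypothesis P_ge0 : forall x y, 0 <= P x y.
Hypothesis row_le1 : forall (F : seq V) x, uniq F -> \sum_(y <- F) P x y <= 1.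
Hypothesis pi_gt0 : forall x, 0 < pi x.
Hypothesis piP_sym : forall x y, pi x * P x y = pi y * P y x.

(** As |g|_1 is only known to be at most 1, the truncation level is |g|^2 / 4; by Markov's
    inequality g exceeds it on mass at most 4 / S <= u. Since |g|^2 is a moment of order 2n, the
    factor 1/2 in the energy bound is recovered. *)
Lemma plazy_decay_level (lam u e S : R) n F f
    (g := iter n (plazy P e F) f) :
  uniq F -> 0 <= lam -> 0 <= e <= 2^-1 -> 0 < u -> 0 < S ->
  (lam%:E <= Lambda P pi u)%E -> (forall x, 0 <= f x) ->
  \sum_(x <- F) pi x * f x <= 1 -> 4 <= u * S -> S <= ip pi F g g ->
  ip pi F g g <= expR (- (n%:R * e * lam)) * ip pi F f f.
Proof.
move=> uF lam0 e2 u0 S0 lamL f0 f1 uS Sg.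
have e01 : 0 <= e <= 1 by case/andP: e2 => -> /= /le_trans; apply; lra.
have g0 x : 0 <= g x by exact: iter_plazy_ge0.
have g1 : \sum_(x <- F) pi x * g x <= 1.
  by apply: le_trans f1; exact: iter_plazy_l1.
pose s := ip pi F g g / 4.
have s0 : 0 < s by rewrite /s; lra.
have gg0 : 0 < ip pi F g g by lra.
have Eg : lam / 2 * ip pi F g g <= En P pi F g.
  apply: (level_energy P_ge0 pi_gt0 piP_sym row_le1 uF lam0 (ltW s0) g0).
    rewrite (_ : 4 * s = ip pi F g g); last by rewrite /s; field.
    by rewrite -[leRHS]mulr1 ler_pM2l.
  move=> k _ ks.
  apply: (Lambda_energy P_ge0 row_le1 pi_gt0 piP_sym (p := fun x => s < g x) uF
    lamL); last by move=> x; rewrite -leNgt; exact: ks.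
  apply: le_trans (markov_mass pi_gt0 F s0 g0) _.
  rewrite ler_pdivrMr//; apply: (le_trans g1); rewrite /s.
  have := ler_wpM2l (ltW u0) Sg; lra.
have e0 : 0 <= e by case/andP: e2.
have eh : e <= 2^-1 by case/andP: e2.
apply: le_trans (plazy_decay P_ge0 pi_gt0 piP_sym row_le1 e0 eh uF Eg) _.
apply: ler_wpM2r; first exact: ip_ge0.
(* The energy is at most 2 |g|^2, which forces lam <= 4. Then 1 - e * lam / 2 is nonnegative and can
   be compared with the exponential before taking powers. *)
have lam4 : lam <= 4.
  have := ip_papp_geN P_ge0 pi_gt0 piP_sym row_le1 g uF.
  move: Eg; rewrite /En => Eg h.
  have : lam * ip pi F g g <= 4 * ip pi F g g by lra.
  by rewrite ler_pM2r.
have x1 : 0 <= 1 - e * (lam / 2) by nra.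
have -> : - (n%:R * e * lam) = (n + n)%:R * (- (e * (lam / 2))).
  by rewrite natrD; field.
rewrite expRM_natl lerXn2r ?nnegrE ?expR_ge0//.
exact: expR_ge1Dx.
Qed.

(** If the flow kept more than 2^-l of the squared norm S of mu / pi, so would a killed walk. The
    level argument then applies because (u 2^(l+2)) (2^-l S) = 4 u S >= 4, and exp(-lam t) <= 2^-l
    is a contradiction. *)
Lemma heat_decay (lam u t : R) l mu : 0 <= lam -> 0 <= t -> 0 < u ->
  (lam%:E <= Lambda P pi (u * 2 ^+ (l + 2)))%E -> l%:R * ln 2 <= lam * t ->
  prob_l2 pi mu -> (1 <= u%:E * mnorm pi 2 mu ^+ 2)%E ->
  (mnorm pi 2 (kact mu (heat P t)) ^+ 2
     <= (2 ^- l)%:E * mnorm pi 2 mu ^+ 2)%E.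
Proof.
move=> lam0 t0 u0 lamL lt [[mu0 mu1] muoo].
have smu : abs_summable mu by apply: (@abs_summableP _ _ _ 1); rewrite ?mu1.
rewrite /mnorm !lnorm_sqr//; set S' := esum _ (fun v => (pi v * (mu v / _) ^+ 2)%:E).
have : (S' `^ 2^-1 < +oo)%E by rewrite -lnormE.
have : (0 <= S')%E.
  by apply: esum_ge0 => x _; rewrite lee_fin mulr_ge0 ?sqr_ge0// ltW.
case ES : S' => [S| |]//; last first.
  by rewrite poweRyr ?ltxx// invr_eq0 pnatr_eq0.
rewrite lee_fin => S0 _.
rewrite -EFinM lee_fin => uS; apply: esum_le => G uG.
rewrite -EFinM lee_fin leNgt; apply/negP => aG.
have [F [n [e [uF e2 ne]]]] := heat_act_approx P_ge0 row_le1 pi_gt0 piP_sym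
  t0 mu0 smu uG aG.
set f := fun x => mu x / pi x; set g := iter n _ f => /= Sg.
have p2 : 0 < 2 ^- l :> R by rewrite invr_gt0 exprn_gt0.
have S_gt0 : 0 < S by rewrite -(pmulr_rgt0 _ u0); apply: lt_le_trans uS.
have ff : ip pi F f f <= S.
  rewrite -lee_fin -ES; apply: le_trans (sum_le_esum uF _).
    by rewrite lee_fin; apply: ler_sum => x _; rewrite expr2 mulrA.
  by move=> x; rewrite mulr_ge0 ?sqr_ge0// ltW.
have : ip pi F g g <= expR (- (n%:R * e * lam)) * ip pi F f f.
  apply: (@plazy_decay_level lam (u * 2 ^+ (l + 2)) e (2 ^- l * S)) => //.
  - by rewrite mulr_gt0// exprn_gt0.
  - exact: mulr_gt0.
  - by move=> x; rewrite divr_ge0// ltW.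
  - rewrite -lee_fin -mu1; apply: le_trans (sum_le_esum uF _) => //.
    rewrite lee_fin; apply: ler_sum => x _.
    by rewrite /f mulrC divfK ?gt_eqF.
  - have -> : u * 2 ^+ (l + 2) * (2 ^- l * S) = 4 * (u * S).
      by rewrite exprD; field; rewrite expf_neq0// pnatr_eq0.
    by rewrite -[leLHS]mulr1 ler_pM2l.
  - exact: ltW.
apply/negP; rewrite -ltNge; apply: le_lt_trans Sg.
rewrite ler_pM ?expR_ge0 ?ip_ge0//.
have -> : 2 ^- l = expR (- (l%:R * ln 2)) :> R.
  by rewrite expRN expRM_natl lnK// posrE.
by rewrite ne ler_expR lerN2 [leRHS]mulrC.
Qed.

Lemma zeta_le u l : 0 < u -> (0 < l)%N ->
  (zeta P pi l u <= (l%:R * ln 2)%:E / Lambda P pi (u * 2 ^+ (l + 2)))%E.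
Proof.
move=> u0 l0; have c0 : 0 < l%:R * ln 2 :> R.
  by rewrite mulr_gt0 ?ltr0n// ln_gt0// ltr1n.
have := Lambda_ge0 P_ge0 row_le1 pi_gt0 piP_sym (u * 2 ^+ (l + 2)).
have zle (lam : R) : 0 < lam -> (lam%:E <= Lambda P pi (u * 2 ^+ (l + 2)))%E ->
    (zeta P pi l u <= (l%:R * ln 2 / lam)%:E)%E.
  move=> lam0 lamL; apply: ereal_inf_lbound; exists (l%:R * ln 2 / lam) => //.
  have t0 : 0 <= l%:R * ln 2 / lam by rewrite divr_ge0// ltW.
  split=> // mu mu2 umu; apply: (heat_decay (ltW lam0) t0 u0 lamL) => //.
  by rewrite [leRHS]mulrC divfK// gt_eqF.
case EL : (Lambda P pi _) zle => [r| |]// zle.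
  rewrite lee_fin le_eqVlt => /orP[/eqP<-|r0].
    by rewrite inver eqxx mulry gtr0_sg// mul1e leey.
  by rewrite inver gt_eqF// -EFinM; exact: zle.
(* If Lambda is infinite every positive lam is admissible, so zeta is at most every e > 0. *)
move=> _; rewrite invey mule0; apply/lee_addgt0Pr => e e0; rewrite add0e.
have := zle (l%:R * ln 2 / e) (divr_gt0 c0 e0) (leey _).
by rewrite invf_div mulrC divfK// gt_eqF.
Qed.

(** Since |pi_B|^2 = 1 / pi(B), the constraint pi(B) <= u is exactly u |mu|^2 >= 1 for mu = pi_B. *)
Lemma chi_le_zeta u l : 0 < u -> (chi P pi l u <= zeta P pi l u)%E.
Proof.
move=> u0; apply: le_ereal_inf_tmp => _ [t [t0 Ht] <-].
apply: ereal_inf_lbound; exists t => //; split=> // B [B0 /finite_seqP[r Br] _].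
have {r Br} [s us Bs] : exists2 s, uniq s & B = [set` s].
  exists (undup r); first exact: undup_uniq.
  by rewrite Br; apply/seteqP; split=> x /=; rewrite mem_undup.
rewrite Bs in B0 * => Bu.
have s0 : s != [::] by apply/eqP => s0; case: B0 => x; rewrite s0.
have m0 := sum_pi_gt0 pi_gt0 s0.
have c0 x : x \notin s -> cond_dist pi [set` s] x = 0.
  by move=> /negPf xs; rewrite cond_dist_seqE// xs !mul0r.
apply: Ht; last first.
  rewrite mnorm_cond_dist// -EFinM lee_fin ler_pdivlMr// mul1r.
  by rewrite mass_seq// lee_fin in Bu.
split; last first.
  rewrite /= /mnorm (@lnorm_support _ _ _ pi_gt0 _ s)// ?ltry//.
  by move=> x /c0 ->; rewrite mul0r.
have p0 x : 0 <= cond_dist pi [set` s] x.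
  by rewrite cond_dist_seqE// !mulr_ge0 ?invr_ge0 ?ler0n// ltW.
split=> //; rewrite (esum_support us)//; congr _%:E.
rewrite -[RHS](divff (lt0r_neq0 m0)) mulr_suml big_seq [RHS]big_seq.
by apply: eq_bigr => x xs; rewrite cond_dist_seqE// xs mul1r.
Qed.

Lemma chi_ge u :
  ((2 ^- 9)%:E / Lambda P pi u <= chi P pi 8 u)%E.
Proof.
apply: le_ereal_inf_tmp => _ [t [t0 Ht] <-].
(* Division by zero returns 0 in R, so at t = 0 the bound by 2^-9 / t says nothing and an infinite
   Lambda is needed instead. *)
have [t_le0|{}t0] := leP t 0.
  have t00 : t = 0 by apply/eqP; rewrite eq_le t_le0 t0.
  rewrite t00 in Ht *.
  by rewrite (Lambda_lower0 P_ge0 row_le1 pi_gt0 piP_sym Ht) invey mule0.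
have := Lambda_lower P_ge0 row_le1 pi_gt0 piP_sym t0 Ht.
have c0 : 0 < 2 ^- 9 / t by apply: divr_gt0 => //; rewrite invr_gt0 exprn_gt0.
case: (Lambda P pi u) => [r| |]//.
  rewrite lee_fin => cr; have r0 : 0 < r by exact: lt_le_trans cr.
  rewrite inver gt_eqF// -EFinM lee_fin ler_pdivrMr// mulrC -ler_pdivrMr//.
by move=> _; rewrite invey mule0 lee_fin ltW.
Qed.

End UpperBound.

Theorem proposition1p6 (R : realType) :
  (forall (V : countType) (P : V -> V -> R) (pi : V -> R),
     infinite_set [set: V] ->
     transition_matrix P -> irreducible_on P [set: V] -> reversible P pi ->
     mass pi [set: V] = +oo%E ->
     forall (u : R) (l : nat), 0 < u -> (0 < l)%N ->
       (chi P pi l u <= zeta P pi l u)%E /\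
       (zeta P pi l u
          <= (l%:R * ln 2)%:E / Lambda P pi (u * 2 ^+ (l + 2)))%E)
  /\
  (exists (l : nat) (c : R), (0 < l)%N /\ 0 < c < 1 /\
     forall (V : countType) (P : V -> V -> R) (pi : V -> R),
     infinite_set [set: V] ->
     transition_matrix P -> irreducible_on P [set: V] -> reversible P pi ->
     mass pi [set: V] = +oo%E ->
     forall u : R, 0 < u ->
       (c%:E / Lambda P pi u <= chi P pi l u)%E /\
       ((c / (l%:R * ln 2))%:E * zeta P pi l (2 ^- (l + 2) * u)
          <= c%:E / Lambda P pi u)%E).
Proof.
have row_le1 (V : countType) (P : V -> V -> R) : transition_matrix P ->
    forall (F : seq V) x, uniq F -> \sum_(y <- F) P x y <= 1.
  move=> [P0 P1] F x uF; rewrite -lee_fin -(P1 x).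
  exact: sum_le_esum.
split.
  move=> V P pi _ tP _ [pi0 piP] _ u l u0 l0; have [P0 _] := tP.
  have r1 := row_le1 V P tP.
  by split; [exact: chi_le_zeta|exact: zeta_le].
exists 8%N, (2 ^- 9); split=> //; split.
  by rewrite invr_gt0 exprn_gt0 ?ltr0n//= invf_lt1 ?exprn_gt0 ?exprn_egt1 ?ltr1n.
move=> V P pi _ tP _ [pi0 piP] _ u u0; have [P0 _] := tP.
have r1 := row_le1 V P tP; split; first exact: chi_ge.
have l2 : 0 < 8%:R * ln 2 :> R by rewrite mulr_gt0// ln_gt0// ltr1n.
have v0 : 0 < 2 ^- (8 + 2) * u by rewrite mulr_gt0// invr_gt0 exprn_gt0.
(* The comparison with zeta is the upper bound at 2^-(l+2) u, where the argument of Lambda becomes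
   u. *)
have := zeta_le P0 r1 pi0 piP v0 (isT : (0 < 8)%N).
have -> : 2 ^- (8 + 2) * u * 2 ^+ (8 + 2) = u.
  by rewrite mulrC mulrA divff ?mul1r// expf_neq0// pnatr_eq0.
have c0 : (0 <= (2 ^- 9 / (8%:R * ln 2) : R)%:E)%E.
  by rewrite lee_fin; apply: divr_ge0; [rewrite invr_ge0 exprn_ge0|exact: ltW].
move=> /(lee_wpmul2l c0)/le_trans; apply.
by rewrite muleA -EFinM divfK ?gt_eqF.
Qed.
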